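(* Let $K$ be a field, let $S_1=K[x_1,\dots,x_n]$ and $S_2=K[y_1,\dots,y_m]$ be polynomial rings in disjoint sets of variables, and let $S=K[x_1,\dots,x_n,y_1,\dots,y_m]$. Let $I_1\subset S_1$ and $I_2\subset S_2$ be squarefree monomial ideals, and let $I_1I_2\subset S$ denote the product of the ideals generated by $I_1$ and $I_2$ in $S$. If $g_{I_1}$ and $g_{I_2}$ are non-increasing functions, then $g_{I_1I_2}$ is a non-increasing function too.
   Context: All squarefree monomial ideals are nonzero and proper. For a squarefree monomial ideal $I$ in a polynomial ring $T$ over $K$, the $k$th squarefree power $I^{[k]}$ is the monomial ideal of $T$ generated by the squarefree monomials belonging to $I^k$. The monomial grade $\nu(I)$ is the biggest length of a monomial regular sequence contained in $I$; equivalently $I^{[k]}\neq(0)$ if and only if $k\le\nu(I)$. For $1\le k\le \nu(I)$, $d_k=\mathrm{indeg}(I^{[k]})$ is the minimum degree of a monomial generator of $I^{[k]}$, and the normalized depth function of $I$ is $g_I(k)=\mathrm{depth}(T/I^{[k]})-(d_k-1)$, a function on $\{1,\dots,\nu(I)\}$. By convention the ambient polynomial ring $T$ is the smallest polynomial ring over $K$ containing the minimal monomial generators of $I$ (every variable divides some minimal generator); here $g_{I_1}$, $g_{I_2}$, $g_{I_1I_2}$ are computed in $S_1$, $S_2$, $S$, respectively. *)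

(* Defs.v *)
From mathcomp Require Import all_boot all_order all_algebra.
From mathcomp Require Import mpoly.
From Stdlib Require Import ClassicalEpsilon.

Set Implicit Arguments.
Unset Strict Implicit.
Unset Printing Implicit Defensive.

Import GRing.Theory.
Local Open Scope ring_scope.

(* Total versions of "the largest / the least natural number satisfying P";
   the value is unspecified when there is none. *)
Definition is_max_nat (P : nat -> Prop) (d : nat) : Prop :=
  P d /\ (forall e : nat, P e -> (e <= d)%N).

Definition is_min_nat (P : nat -> Prop) (d : nat) : Prop :=
  P d /\ (forall e : nat, P e -> (d <= e)%N).

Definition max_nat (P : nat -> Prop) : nat :=
  epsilon (inhabits 0%N) (is_max_nat P).

Definition min_nat (P : nat -> Prop) : nat :=
  epsilon (inhabits 0%N) (is_min_nat P).

(* Ideals are represented by their membership predicates, and compared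
   extensionally. *)
Section Ideals.
Variable R : comNzRingType.
Implicit Types (G I J : R -> Prop) (s : seq R).

Definition ideal_gen G : R -> Prop := fun p =>
  exists2 c : seq (R * R),
    (forall ag, ag \in c -> G ag.2) & p = \sum_(ag <- c) ag.1 * ag.2.

Definition ideal_mul I J : R -> Prop :=
  ideal_gen (fun p => exists a b : R, [/\ I a, J b & p = a * b]).

Fixpoint ideal_pow I (k : nat) : R -> Prop :=
  if k is k'.+1 then ideal_mul I (ideal_pow I k') else fun _ => True.

Definition ideal_adjoin J s : R -> Prop :=
  ideal_gen (fun p => J p \/ p \in s).

(* s is a regular sequence on the module R/J: each s_i is a nonzerodivisor on
   R/(J, s_0, ..., s_(i-1)), and (R/J)/s(R/J) = R/(J + (s)) is nonzero. *)
Definition regular_on_quotient J s : Prop :=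
  (forall i : nat, (i < size s)%N -> forall p : R,
     ideal_adjoin J (take i s) (s`_i * p) -> ideal_adjoin J (take i s) p)
  /\ ~ ideal_adjoin J s 1.

End Ideals.

Section MonomialIdeals.
Variables (K : fieldType) (n : nat).
Local Notation T := {mpoly K[n]}.
Implicit Types (I J : T -> Prop) (u v : 'X_{1..n}).

Definition sqfree_mnm u : Prop := forall i : 'I_n, (u i <= 1)%N.

Definition mnm_ideal (A : 'X_{1..n} -> Prop) : T -> Prop :=
  ideal_gen (fun p => exists2 u, A u & p = 'X_[u]).

Definition sqfree_monomial_ideal I : Prop :=
  [/\ exists2 A : 'X_{1..n} -> Prop,
        (forall u, A u -> sqfree_mnm u) & (forall p, I p <-> mnm_ideal A p),
      exists2 p, I p & p != 0
    & ~ I 1].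

(* On multi-exponents, (v <= u)%MM is divisibility of 'X_[u] by 'X_[v]. *)
Definition min_generator I u : Prop :=
  I 'X_[u] /\ (forall v, I 'X_[v] -> (v <= u)%MM -> v = u).

(* The ambient ring T is the smallest polynomial ring containing the minimal
   monomial generators of I. *)
Definition full_support I : Prop :=
  forall i : 'I_n, exists2 u, min_generator I u & (0 < u i)%N.

Definition sqfree_pow I (k : nat) : T -> Prop :=
  mnm_ideal (fun u => sqfree_mnm u /\ ideal_pow I k 'X_[u]).

(* The nonzero scalar factor a monomial could carry is irrelevant to
   regularity, so monomials are taken monic. Regularity is on T = T/(0). *)
Definition monomial_grade I : nat :=
  max_nat (fun r => exists s : seq 'X_{1..n},
    [/\ size s = r,
        forall u, u \in s -> I 'X_[u]
      & regular_on_quotient (fun p : T => p = 0)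
          [seq ('X_[u] : T) | u <- s]]).

Definition irrelevant_ideal : T -> Prop :=
  ideal_gen (fun p => exists i : 'I_n, p = 'X_i).

(* depth (T/J): the largest length of a (T/J)-regular sequence contained in
   the graded maximal ideal of T. *)
Definition quotient_depth J : nat :=
  max_nat (fun r => exists s : seq T,
    [/\ size s = r,
        forall f, f \in s -> irrelevant_ideal f
      & regular_on_quotient J s]).

Definition indeg J : nat :=
  min_nat (fun d => exists2 u, min_generator J u & mdeg u = d).

Definition norm_depth I (k : nat) : int :=
  (quotient_depth (sqfree_pow I k))%:Z - ((indeg (sqfree_pow I k))%:Z - 1).

Definition norm_depth_nonincreasing I : Prop :=
  forall k l : nat, (1 <= k)%N -> (k <= l)%N -> (l <= monomial_grade I)%N ->
    norm_depth I l <= norm_depth I k.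

End MonomialIdeals.

(* In {mpoly K[n + m]} the variables x_1, ..., x_n are the 'X_(lshift m i) and
   y_1, ..., y_m are the 'X_(rshift n j). *)
Section DisjointVariables.
Variables (K : fieldType) (n m : nat).

Definition extend_left (I : {mpoly K[n]} -> Prop) : {mpoly K[n + m]} -> Prop :=
  ideal_gen (fun q => exists2 p, I p &
    q = p \mPo [tuple ('X_(lshift m i) : {mpoly K[n + m]}) | i < n]).

Definition extend_right (I : {mpoly K[m]} -> Prop) : {mpoly K[n + m]} -> Prop :=
  ideal_gen (fun q => exists2 p, I p &
    q = p \mPo [tuple ('X_(rshift n j) : {mpoly K[n + m]}) | j < m]).

Definition disjoint_product (I1 : {mpoly K[n]} -> Prop)
    (I2 : {mpoly K[m]} -> Prop) : {mpoly K[n + m]} -> Prop :=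
  ideal_mul (extend_left I1) (extend_right I2).

End DisjointVariables.

(* Main.v *)
Require Import Defs.
From HB Require Import structures.
From mathcomp Require Import all_boot all_order all_algebra.
From mathcomp Require Import mpoly.
From mathcomp Require Import ring zify.
From Stdlib Require Import Classical ClassicalEpsilon FunctionalExtensionality
  PropExtensionality.

Set Implicit Arguments.
Unset Strict Implicit.
Unset Printing Implicit Defensive.

Import Order.TTheory GRing.Theory Num.Theory.
Local Open Scope ring_scope.

(** For [1 <= k <= nu(I1 I2)] the normalized depth functions satisfy
    [g_{I1 I2}(k) = g_{I1}(k) + g_{I2}(k)] ([norm_depth_product]).  Since
    [nu(I1 I2)] is at most [nu(I1)] and at most [nu(I2)], a sum of two
    non-increasing functions appears on the whole range and the theorem follows.

    Write [J1], [J2] for the ideals of [S] generated by the [k]th squarefree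
    powers of [I1] and [I2].  The variables being disjoint, the [k]th squarefree
    power of [I1 I2] is the intersection of [J1] and [J2]
    ([sqfree_pow_product], [cap_ext_mnm]) and initial degrees add up
    ([indeg_join]).  What remains is the depth formula [depth_join]: if
    [d1] and [d2] are the depths of [S1] and [S2] modulo the two squarefree
    powers, then [S] modulo [J1 cap J2] has depth [d1 + d2 + 1].  In the exact sequence
       [0 -> S/(J1 cap J2) -> S/J1 + S/J2 -> S/(J1 + J2) -> 0]
    the right-hand term is a tensor product over [K] and has depth [d1 + d2],
    whereas [S/J1] and [S/J2] have depths [d1 + m] and [n + d2], both larger
    because a nonzero monomial ideal has a quotient of depth less than the
    number of variables ([depth_lt]).

    Depth is controlled by generic elements instead of Ext or Koszul homology.
    Let [xs] generate an ideal of a ring [R].  If no nonzero element of [R/J] is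
    killed by [xs], then the generic combination [h], the sum of the
    [xs_i t^i], is regular on [(R/J)[t]] ([generic_regular], a form of McCoy's
    theorem).  Iterating over [R[t]] modulo [J] and [h] until a killed element
    appears defines a number ([grade_eq]) which does not depend on any choice.
    An exchange argument shows that every regular sequence in [(xs)] whose
    quotient contains a nonzero element killed by [xs] has exactly that length
    ([regseq_grade_eq]), and that every other one is at most as long
    ([regseq_grade_ge]).  Because one [h] serves for all modules at once, the
    usual depth count along the exact sequence becomes a short computation with
    ideals ([grade_eq_cap]).

    Two facts link this number to sequences of polynomials.  Over a Noetherian
    ring a quotient without elements killed by [xs] has a regular element in
    [(xs)] ([ex_regular]), so maximal regular sequences end in a quotient with
    such an element ([ex_maximal_regseq]); and normal forms with respect to
    leading monomials supply a [K]-basis of [S2/B], by which regular sequences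
    of both factors stay regular modulo the sum of the extended ideals
    ([tensor_mem], [disjoint_regseq]). *)

(** * Ideals as membership predicates and regular sequences *)

Lemma pred_ext (T : Type) (A B : T -> Prop) : (forall x, A x <-> B x) -> A = B.
Proof.
move=> eqAB; apply: functional_extensionality => x.
exact: propositional_extensionality.
Qed.

Section Ideals.
Variable R : comNzRingType.
Implicit Types (I J A B : R -> Prop) (s xs : seq R) (f g h p u : R).

Definition is_ideal J : Prop :=
  [/\ J 0, forall p q, J p -> J q -> J (p + q) & forall a p, J p -> J (a * p)].

Definition zero_ideal : R -> Prop := fun p => p = 0.

(** The ideal [J + (f)]. *)
Definition adj J f : R -> Prop := fun p => exists a, J (p - a * f).

Definition adjs J s : R -> Prop := foldl adj J s.

Definition regular J f : Prop := forall p, J (f * p) -> J p.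

Fixpoint regseq J s : Prop :=
  if s is f :: s' then regular J f /\ regseq (adj J f) s' else True.

Definition sum_ideal A B : R -> Prop := fun p => exists2 a, A a & B (p - a).

Definition cap_ideal A B : R -> Prop := fun p => A p /\ B p.

(** The ideal generated by [xs], as the intersection of all ideals containing
    it: maps between rings are then transported by pulling ideals back. *)
Definition in_span xs f : Prop :=
  forall I, is_ideal I -> {in xs, forall x, I x} -> I f.

(** [u] represents a nonzero element of [R/J] annihilated by [xs]. *)
Definition socle J xs u : Prop := ~ J u /\ {in xs, forall x, J (x * u)}.

Definition has_socle J xs : Prop := exists u, socle J xs u.

Definition no_socle J xs : Prop :=
  forall u, {in xs, forall x, J (x * u)} -> J u.

Section IdealOps.
Variable J : R -> Prop.
Hypothesis idJ : is_ideal J.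

Lemma ideal_zero : J 0. Proof. by case: idJ. Qed.
Lemma ideal_add p q : J p -> J q -> J (p + q). Proof. by case: idJ => _ h _; exact: h. Qed.
Lemma ideal_mull a p : J p -> J (a * p). Proof. by case: idJ => _ _ h; exact: h. Qed.
Lemma ideal_mulr a p : J p -> J (p * a). Proof. by rewrite mulrC; exact: ideal_mull. Qed.
Lemma ideal_opp p : J p -> J (- p). Proof. by rewrite -mulN1r; exact: ideal_mull. Qed.
Lemma ideal_sub p q : J p -> J q -> J (p - q).
Proof. by move=> Jp Jq; apply: ideal_add => //; exact: ideal_opp. Qed.

Lemma ideal_sum (X : Type) (r : seq X) (P : pred X) (F : X -> R) :
  (forall x, P x -> J (F x)) -> J (\sum_(x <- r | P x) F x).
Proof. by move=> JF; apply: big_ind => //; [exact: ideal_zero | exact: ideal_add]. Qed.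

Lemma adj_ideal f : is_ideal (adj J f).
Proof.
split=> [|p q [a Ja] [b Jb]|a p [b Jb]].
- by exists 0; rewrite mul0r subr0; exact: ideal_zero.
- by exists (a + b); rewrite (_ : _ - _ = (p - a * f) + (q - b * f)); [exact: ideal_add | ring].
- by exists (a * b); rewrite (_ : _ - _ = a * (p - b * f)); [exact: ideal_mull | ring].
Qed.

Lemma sub_adj f p : J p -> adj J f p.
Proof. by move=> Jp; exists 0; rewrite mul0r subr0. Qed.

Lemma mem_adj f a : adj J f (a * f).
Proof. by exists a; rewrite subrr; exact: ideal_zero. Qed.

Lemma gen_adj f : adj J f f.
Proof. by rewrite -[X in adj _ _ X]mul1r; exact: mem_adj. Qed.

Lemma adj_min I f : is_ideal I -> (forall p, J p -> I p) -> I f ->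
  forall p, adj J f p -> I p.
Proof.
move=> [_ ID IM] JI If p [a Ja]; rewrite -(subrK (a * f) p).
by apply: ID; [exact: JI | exact: IM].
Qed.

Lemma has_socleN xs : ~ has_socle J xs -> no_socle J xs.
Proof. by move=> nos u Ju; apply: NNPP => nJu; apply: nos; exists u. Qed.

Lemma no_socleN xs : no_socle J xs -> ~ has_socle J xs.
Proof. by move=> nos [u [nJu]] /nos. Qed.

Lemma span_colon xs f u : in_span xs f -> {in xs, forall x, J (x * u)} -> J (f * u).
Proof.
move=> xsf Ju; apply: (xsf (fun x => J (x * u))) => //.
split=> [|p q|a p]; first by rewrite mul0r; exact: ideal_zero.
- by rewrite mulrDl; exact: ideal_add.
- by rewrite -mulrA; exact: ideal_mull.
Qed.

End IdealOps.

Lemma adjs_ideal J s : is_ideal J -> is_ideal (adjs J s).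
Proof.
by elim: s J => [|f s IH] J idJ //=; apply: IH; exact: adj_ideal.
Qed.

Lemma sub_adjs J s p : J p -> adjs J s p.
Proof.
by elim: s J => [|f s IH] J //= Jp; apply: IH; exact: sub_adj.
Qed.

Lemma mem_adjs J s f : is_ideal J -> f \in s -> adjs J s f.
Proof.
elim: s J => [|g s IH] J idJ //=; rewrite inE => /predU1P[->|fs].
  by apply: sub_adjs; exact: gen_adj.
by apply: IH => //; exact: adj_ideal.
Qed.

(** With [sub_adjs] and [mem_adjs]: [adjs J s] is the least ideal containing [J]
    and [s], which identifies it with the ideal built from explicit linear
    combinations. *)
Lemma adjs_min J s I : is_ideal J -> is_ideal I -> (forall p, J p -> I p) ->
  {in s, forall f, I f} -> forall p, adjs J s p -> I p.
Proof.
elim: s J => [|f s IH] J idJ idI JI sI //=.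
apply: IH => //; first exact: adj_ideal.
  by apply: (adj_min idI JI); apply: sI; rewrite inE eqxx.
by move=> g gs; apply: sI; rewrite inE gs orbT.
Qed.

Lemma adjC J f g : adj (adj J f) g = adj (adj J g) f.
Proof.
by apply: pred_ext => p; split=> -[a [b Jab]]; exists b, a; rewrite addrAC.
Qed.

Lemma adjs_adj J f s : adjs (adj J f) s = adj (adjs J s) f.
Proof. by elim: s J => [|g s IH] J //=; rewrite adjC IH. Qed.

Lemma zero_ideal_ideal : is_ideal zero_ideal.
Proof.
by split=> // [p q|a p] ->; [move=> ->; rewrite addr0 | rewrite mulr0].
Qed.

Lemma sum_ideal_ideal A B : is_ideal A -> is_ideal B -> is_ideal (sum_ideal A B).
Proof.
move=> idA idB; split=> [|p q [a Aa Ba] [b Ab Bb]|c p [a Aa Ba]].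
- by exists 0; rewrite ?subr0; exact: ideal_zero.
- exists (a + b); first exact: ideal_add.
  by rewrite (_ : _ - _ = (p - a) + (q - b)); [exact: ideal_add | ring].
- exists (c * a); first exact: ideal_mull.
  by rewrite -mulrBr; exact: ideal_mull.
Qed.

Lemma sum_idealC A B : is_ideal A -> is_ideal B -> sum_ideal A B = sum_ideal B A.
Proof.
move=> idA idB.
by apply: pred_ext => p; split=> -[a Aa Ba]; exists (p - a) => //; rewrite subKr.
Qed.

Lemma sum_ideal_subl A B p : is_ideal B -> A p -> sum_ideal A B p.
Proof. by move=> idB Ap; exists p => //; rewrite subrr; exact: ideal_zero. Qed.

Lemma sum_ideal_subr A B p : is_ideal A -> B p -> sum_ideal A B p.
Proof. by move=> idA Bp; exists 0; rewrite ?subr0 //; exact: ideal_zero. Qed.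

Lemma sum_adjl A B f : is_ideal A -> is_ideal B ->
  sum_ideal (adj A f) B = adj (sum_ideal A B) f.
Proof.
move=> idA idB; apply: pred_ext => p; split.
  case=> a [c Ac] Bpa; exists c; exists (a - c * f) => //.
  by rewrite (_ : _ - _ = p - a) //; ring.
case=> c [a Aa Bp]; exists (a + c * f); first by exists c; rewrite addrK.
by rewrite (_ : _ - _ = p - c * f - a) //; ring.
Qed.

Lemma sum_adj A B f : is_ideal A -> is_ideal B ->
  sum_ideal (adj A f) (adj B f) = adj (sum_ideal A B) f.
Proof.
move=> idA idB; rewrite sum_adjl //; last exact: adj_ideal.
rewrite (sum_idealC idA) ?sum_adjl ?(sum_idealC idB idA) //; last exact: adj_ideal.
have idS := sum_ideal_ideal idA idB.
apply: pred_ext => p; split; last exact: sub_adj.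
apply: (adj_min (adj_ideal idS f)) => //.
exact: gen_adj.
Qed.

Lemma regular_no_socle J xs f : is_ideal J ->
  sum_ideal J (in_span xs) f -> regular J f -> no_socle J xs.
Proof.
move=> idJ [a Ja xsa] regf u Ju; apply: regf; rewrite -[f](subrK a) mulrDl.
by apply: ideal_add => //; [exact: span_colon xsa Ju | exact: ideal_mulr].
Qed.

Lemma ideal_gen_ideal G : is_ideal (@ideal_gen R G).
Proof.
split=> [|p q [c1 G1 ->] [c2 G2 ->]|a p [c Gc ->]].
- by exists [::]; rewrite ?big_nil.
- exists (c1 ++ c2); last by rewrite big_cat.
  by move=> ag; rewrite mem_cat => /orP[/G1|/G2].
- exists [seq (a * ag.1, ag.2) | ag <- c]; last first.
    by rewrite big_map mulr_sumr; apply: eq_bigr => ag _ /=; rewrite mulrA.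
  by move=> ag /mapP[ag' /Gc Gag' ->].
Qed.

Lemma ideal_gen_min G I : is_ideal I -> (forall p, G p -> I p) ->
  forall p, @ideal_gen R G p -> I p.
Proof.
move=> idI GI p [c Gc ->]; rewrite big_seq; apply: ideal_sum => // ag /Gc Gag.
by apply: ideal_mull => //; exact: GI.
Qed.

Lemma mem_ideal_gen (G : R -> Prop) p : G p -> ideal_gen G p.
Proof.
move=> Gp; exists [:: (1, p)]; last by rewrite big_seq1 mul1r.
by move=> ag; rewrite inE => /eqP->.
Qed.

Lemma ideal_adjoinE J s : is_ideal J -> ideal_adjoin J s = adjs J s.
Proof.
move=> idJ; apply: pred_ext => p; split.
  apply: ideal_gen_min; first exact: adjs_ideal.
  by move=> q [Jq|qs]; [exact: sub_adjs | exact: mem_adjs].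
apply: adjs_min => //; first exact: ideal_gen_ideal.
  by move=> q Jq; apply: mem_ideal_gen; left.
by move=> f fs; apply: mem_ideal_gen; right.
Qed.

Lemma regseqP J s : regseq J s <->
  (forall i, (i < size s)%N -> regular (adjs J (take i s)) s`_i).
Proof.
elim: s J => [|f s IH] J /=; first by split.
split=> [[regf /IH regs] [|i] //= lti|regs]; first exact: regs.
split; first exact: (regs 0%N).
by apply/IH => i lti; exact: (regs i.+1).
Qed.

(** The recursive [regseq] is the form suited to inductions in which the ideal
    and the ring both change. *)
Lemma regular_on_quotientE J s : is_ideal J ->
  regular_on_quotient J s <-> regseq J s /\ ~ adjs J s 1.
Proof.
move=> idJ; rewrite /regular_on_quotient ideal_adjoinE //.
have E : (forall i, (i < size s)%N -> forall p, ideal_adjoin J (take i s) (s`_i * p) ->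
    ideal_adjoin J (take i s) p) <-> regseq J s.
  rewrite regseqP; split=> H i lti p; last by rewrite !ideal_adjoinE //; exact: H.
  by have := H i lti p; rewrite !ideal_adjoinE.
by split=> -[/E ? ?].
Qed.

Lemma regseq_cat J s1 s2 : regseq J (s1 ++ s2) <-> regseq J s1 /\ regseq (adjs J s1) s2.
Proof.
elim: s1 J => [|f s1 IH] J /=; first by split=> [|[]].
by split=> [[rf /IH[]]|[[rf r1] r2]]; split=> //; apply/IH.
Qed.

Lemma adjs_cat J s1 s2 : adjs J (s1 ++ s2) = adjs (adjs J s1) s2.
Proof. exact: foldl_cat. Qed.

End Ideals.

(** * Generic elements over a polynomial extension *)

Section PolynomialExtension.
Variable R : comNzRingType.
Implicit Types (J A B : R -> Prop) (s xs : seq R) (f u : R) (p q h : {poly R}).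

(** The extension [J R[t]]; thus [R[t]] modulo it is [(R/J)[t]]. *)
Definition poly_ideal J : {poly R} -> Prop := fun p => forall i, J p`_i.

Lemma poly_ideal_ideal J : is_ideal J -> is_ideal (poly_ideal J).
Proof.
move=> idJ; split=> [i|p q Jp Jq i|a p Jp i].
- by rewrite coef0; exact: ideal_zero.
- by rewrite coefD; exact: ideal_add.
- by rewrite coefM; apply: ideal_sum => // j _; exact: ideal_mull.
Qed.

Lemma poly_idealC J u : is_ideal J -> poly_ideal J u%:P <-> J u.
Proof.
move=> idJ; split=> [/(_ 0%N)|Ju i]; first by rewrite coefC.
by rewrite coefC; case: ifP => // _; exact: ideal_zero.
Qed.

Lemma poly_ideal_adj J f : is_ideal J -> poly_ideal (adj J f) = adj (poly_ideal J) f%:P.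
Proof.
move=> idJ; apply: pred_ext => p; split; last first.
  by case=> a Ja i; exists a`_i; have := Ja i; rewrite coefB coefMC.
move=> Jp; pose a i := epsilon (inhabits 0) (fun a => J (p`_i - a * f)).
exists (\poly_(i < size p) a i) => i; rewrite coefB coefMC coef_poly.
case: ltnP => [_|lei]; first exact: (epsilon_spec (inhabits 0) _ (Jp i)).
by rewrite nth_default // mul0r subr0; exact: ideal_zero.
Qed.

Lemma poly_ideal_adjs J s : is_ideal J ->
  poly_ideal (adjs J s) = adjs (poly_ideal J) (map polyC s).
Proof.
elim: s J => [|f s IH] J idJ //=.
by rewrite IH ?poly_ideal_adj //; exact: adj_ideal.
Qed.

Lemma poly_ideal_sum A B : is_ideal A -> is_ideal B ->
  poly_ideal (sum_ideal A B) = sum_ideal (poly_ideal A) (poly_ideal B).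
Proof.
move=> idA idB; apply: pred_ext => p; split; last first.
  by case=> a Aa Ba i; exists a`_i => //; have := Ba i; rewrite coefB.
move=> Sp; pose a i := epsilon (inhabits 0) (fun a => A a /\ B (p`_i - a)).
have aP i : A (a i) /\ B (p`_i - a i).
  have [b Ab Bb] := Sp i.
  exact: (epsilon_spec (inhabits 0) (fun a => A a /\ B (p`_i - a)) (ex_intro _ b (conj Ab Bb))).
exists (\poly_(i < size p) a i) => i; rewrite ?coefB coef_poly; case: ltnP => lei.
- by case: (aP i).
- exact: ideal_zero.
- by case: (aP i).
- by rewrite nth_default // subr0; exact: ideal_zero.
Qed.

Lemma poly_ideal_cap A B :
  poly_ideal (cap_ideal A B) = cap_ideal (poly_ideal A) (poly_ideal B).
Proof.
apply: pred_ext => p; split=> [Sp|[Ap Bp] i]; first by split=> i; case: (Sp i).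
by split.
Qed.

Lemma poly_regular J f : regular J f -> regular (poly_ideal J) f%:P.
Proof. by move=> regf p Jfp i; apply: regf; rewrite -coefCM. Qed.

Lemma poly_regseq J s : is_ideal J -> regseq J s ->
  regseq (poly_ideal J) (map polyC s).
Proof.
elim: s J => [|f s IH] J idJ //= [regf regs]; split; first exact: poly_regular.
by rewrite -poly_ideal_adj //; apply: IH => //; exact: adj_ideal.
Qed.

Lemma poly_socle J xs u : is_ideal J -> socle J xs u ->
  socle (poly_ideal J) (map polyC xs) u%:P.
Proof.
move=> idJ [nJu Ju]; split; first by rewrite poly_idealC.
by move=> _ /mapP[x xsx ->]; rewrite -polyCM poly_idealC //; exact: Ju.
Qed.

Lemma poly_span xs f : in_span xs f -> in_span (map polyC xs) f%:P.
Proof.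
move=> xsf I idI Ixs; apply: (xsf (fun u => I u%:P)) => [|x xsx]; last first.
  by apply: Ixs; exact: map_f.
split=> [|p q|a p]; first by rewrite polyC0; exact: ideal_zero.
  by rewrite polyCD; exact: ideal_add.
by rewrite polyCM; exact: ideal_mull.
Qed.

Lemma mem_span xs x : x \in xs -> in_span xs x.
Proof. by move=> xsx I _; exact. Qed.

Lemma generic_span xs : in_span (map polyC xs) (Poly xs).
Proof.
move=> I idI Ixs; rewrite -(coefK (Poly xs)) poly_def.
apply: ideal_sum => // i _; rewrite -mul_polyC; apply: (ideal_mulr idI).
rewrite coef_Poly; case: (ltnP i (size xs)) => lti; last first.
  by rewrite nth_default //; exact: (ideal_zero idI).
by apply: Ixs; apply: map_f; exact: mem_nth.
Qed.

(** McCoy's theorem for the generic combination [h] of [xs].  Take [p] with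
    [h p] in [J[t]] and top coefficient [c].  Going down from the last
    generator, the top coefficient of [h p] shows [xs_i c] in [J], so [xs_i p]
    has smaller degree modulo [J] and lies in [J[t]] by induction.  Hence [c] is
    killed by [xs], so it is in [J] and can be removed from [p]. *)
Lemma generic_regular J xs : is_ideal J -> no_socle J xs ->
  regular (poly_ideal J) (Poly xs).
Proof.
move=> idJ nos.
have idP := poly_ideal_ideal idJ.
suff H N : forall p, (size p <= N)%N -> poly_ideal J (Poly xs * p) -> poly_ideal J p.
  by move=> p; exact: (H (size p)).
elim: N => [|N IH] p.
  by rewrite leqn0 size_poly_eq0 => /eqP-> _; exact: ideal_zero.
move=> lepN Jhp; set c := p`_N.
pose q := p - c *: 'X^N.
have qN : (size q <= N)%N.
  apply/leq_sizeP => j; rewrite leq_eqVlt coefB coefZ coefXn => /predU1P[<-|ltNj].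
    by rewrite eqxx mulr1 subrr.
  rewrite gtn_eqF // mulr0 subr0 nth_default //; exact: leq_trans lepN ltNj.
have monJ a : J a -> poly_ideal J (a *: 'X^N).
  by move=> Ja i; rewrite coefZ; exact: ideal_mulr.
have pE : p = q + c *: 'X^N by rewrite subrK.
have top k : forall i, (size xs - k <= i)%N -> poly_ideal J ((xs`_i)%:P * p).
  elim: k => [|k IHk] i.
    by rewrite subn0 => lei; rewrite nth_default // mul0r; exact: ideal_zero.
  rewrite subnS => lei.
  have Jhigh j : (i < j)%N -> poly_ideal J ((xs`_j)%:P * p).
    by move=> ltij; apply: IHk; move: lei ltij; case: (size xs - k)%N => //= l; exact: leq_ltn_trans.
  have Jc : J (xs`_i * c).
    (* the terms j < i vanish for degree reasons, the terms j > i are in J *)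
    have := Jhp (i + N)%N; rewrite coefM.
    have lti' : (i < (i + N).+1)%N by rewrite ltnS leq_addr.
    rewrite (bigD1 (Ordinal lti')) //= coef_Poly addKn => Jsum.
    rewrite -[X in J X](addrK (\sum_(j < (i + N).+1 | j != Ordinal lti')
      (Poly xs)`_j * p`_(i + N - j))).
    apply: ideal_sub => //; apply: ideal_sum => // j; rewrite -val_eqE /= coef_Poly => neji.
    case: (ltnP i j) => [ltij|leji]; first by rewrite -coefCM; exact: Jhigh.
    have ltji : (j < i)%N by rewrite ltn_neqAle neji.
    rewrite [p`__]nth_default ?mulr0; first exact: ideal_zero.
    by apply: leq_trans lepN _; rewrite ltn_subRL ltn_add2r.
  have Jq : poly_ideal J ((xs`_i)%:P * q).
    apply: IH.
      by rewrite mul_polyC; exact: leq_trans (size_scale_leq _ _) qN.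
    rewrite (_ : _ * _ = (xs`_i)%:P * (Poly xs * p) - Poly xs * ((xs`_i * c) *: 'X^N)).
      by apply: (ideal_sub idP); apply: (ideal_mull idP) => //; exact: monJ.
    by rewrite /q -!mul_polyC polyCM; ring.
  rewrite pE mulrDr; apply: (ideal_add idP) => //.
  by rewrite mul_polyC scalerA; exact: monJ.
have Jc : J c.
  apply: nos => x xsx; have := top (size xs) (index x xs); rewrite subnn nth_index //.
  by move=> /(_ isT N); rewrite coefCM.
rewrite pE; apply: (ideal_add idP); last exact: monJ.
apply: IH => //; rewrite /q mulrBr; apply: (ideal_sub idP) => //.
by apply: (ideal_mull idP); exact: monJ.
Qed.

End PolynomialExtension.

(** * Exchanging regular elements *)

Section Exchange.
Variable R : comNzRingType.
Implicit Types (J A B : R -> Prop) (s xs : seq R) (f h u : R).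

(** Both socles are incarnations of [Ext^1]: if [u] is killed by [xs] modulo
    [J + (f)], then [h u = v f] modulo [J] for some [v], and [v] is killed by
    [xs] modulo [J + (h)]. *)
Lemma exchange_socle J xs f h : is_ideal J ->
  in_span xs f -> in_span xs h -> regular J f -> regular J h ->
  has_socle (adj J f) xs -> has_socle (adj J h) xs.
Proof.
move=> idJ xsf xsh regf regh [u [nJu Ju]].
have [v Jv] : adj J f (h * u) by apply: span_colon xsh Ju; exact: adj_ideal.
exists v; split=> [[w Jw]|x /Ju[w Jw]].
  apply: nJu; exists w; apply: regh.
  rewrite (_ : _ * _ = (h * u - v * f) + f * (v - w * h)); last by ring.
  by apply: ideal_add => //; exact: ideal_mull.
exists w; apply: regf.
rewrite (_ : _ * _ = h * (x * u - w * f) - x * (h * u - v * f)); last by ring.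
by apply: ideal_sub => //; exact: ideal_mull.
Qed.

(** [h] is regular modulo [J] together with each proper prefix of [s]. *)
Fixpoint regular_along J h s : Prop :=
  if s is f :: s' then regular J h /\ regular_along (adj J f) h s' else True.

Lemma swap_regular J f h : is_ideal J ->
  regular J f -> regular (adj J f) h -> regular J h -> regular (adj J h) f.
Proof.
move=> idJ regf regfh regh p [v Jv].
have [w Jw] : adj J f v.
  apply: regfh; exists p.
  by rewrite (_ : _ - _ = - (f * p - v * h)); [exact: ideal_opp | ring].
exists w; apply: regf.
rewrite (_ : _ * _ = (f * p - v * h) + h * (v - w * f)); last by ring.
by apply: ideal_add => //; exact: ideal_mull.
Qed.

(** [h] can replace the last entry of the sequence, and then move to the front
    because it is regular at every earlier stage ([swap_regular]). *)
Lemma swap_regseq J h f0 s : is_ideal J -> regseq J (f0 :: s) ->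
  regular_along J h (f0 :: s) -> regseq (adj J h) (belast f0 s).
Proof.
elim: s J f0 => [|f1 s IH] J f0 idJ //= [regf0 regs] [regh [regh0 regs']].
split; first exact: swap_regular.
by rewrite adjC; apply: IH => //; exact: adj_ideal.
Qed.

(** The previous exchange keeps the socle of the final quotient nonzero, by
    [exchange_socle] at the last step. *)
Lemma swap_socle J xs h f0 s : is_ideal J -> regseq J (f0 :: s) ->
  regular_along J h (f0 :: s) -> in_span xs h -> {in f0 :: s, forall f, in_span xs f} ->
  has_socle (adjs J (f0 :: s)) xs -> has_socle (adjs (adj J h) (belast f0 s)) xs.
Proof.
elim: s J f0 => [|f1 s IH] J f0 idJ [regf0 regs] [regh regs'] xsh xss /=.
  by apply: (exchange_socle idJ _ xsh) => //; apply: xss; rewrite inE.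
rewrite (adjC J h) => soc; apply: IH => //; first exact: adj_ideal.
by move=> f fs; apply: xss; rewrite inE fs orbT.
Qed.

End Exchange.

(** * Grade by generic elements *)

(** The grade of [(xs)] on [R/J], computed by adjoining one generic element
    after another, each over a new polynomial variable.  The successive quotients are
    determined by [J] and [xs], so the number of steps before a
    socle element shows up is an invariant. *)
Fixpoint grade_eq (r : nat) : forall R : comNzRingType, (R -> Prop) -> seq R -> Prop :=
  if r is r'.+1 then fun R J xs => no_socle J xs /\
    @grade_eq r' {poly R} (adj (poly_ideal J) (Poly xs)) (map polyC xs)
  else fun R J xs => has_socle J xs.

Fixpoint grade_ge (r : nat) : forall R : comNzRingType, (R -> Prop) -> seq R -> Prop :=
  if r is r'.+1 then fun R J xs => no_socle J xs /\
    @grade_ge r' {poly R} (adj (poly_ideal J) (Poly xs)) (map polyC xs)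
  else fun R J xs => True.

Arguments grade_eq r {R} J xs.
Arguments grade_ge r {R} J xs.

Lemma grade_eq_ge r s (R : comNzRingType) (J : R -> Prop) xs :
  grade_eq r J xs -> grade_ge s J xs -> (s <= r)%N.
Proof.
elim: r s R J xs => [|r IH] [|s] R J xs //=.
  by move=> soc [/no_socleN].
by move=> [_ eqr] [_ ges]; exact: IH eqr ges.
Qed.

Lemma grade_eq_leq r s (R : comNzRingType) (J : R -> Prop) xs :
  grade_eq r J xs -> (s <= r)%N -> grade_ge s J xs.
Proof.
elim: r s R J xs => [|r IH] [|s] R J xs //= [nos eqr] lesr.
by split=> //; exact: IH eqr lesr.
Qed.

Lemma grade_ge_leq r s (R : comNzRingType) (J : R -> Prop) xs :
  grade_ge r J xs -> (s <= r)%N -> grade_ge s J xs.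
Proof.
elim: r s R J xs => [|r IH] [|s] R J xs //= [nos eqr] lesr.
by split=> //; exact: IH eqr lesr.
Qed.

Lemma grade_eq_inj r s (R : comNzRingType) (J : R -> Prop) xs :
  grade_eq r J xs -> grade_eq s J xs -> r = s.
Proof.
move=> eqr eqs; apply/eqP; rewrite eqn_leq.
by rewrite (grade_eq_ge eqr (grade_eq_leq eqs (leqnn s)))
           (grade_eq_ge eqs (grade_eq_leq eqr (leqnn r))).
Qed.

Section RegularSequences.
Variable R : comNzRingType.
Implicit Types (J A B : R -> Prop) (s xs : seq R) (f h u : R).

(** A regular sequence inside [J + (xs)] keeps all its intermediate quotients
    without socle, so one and the same generic element is regular on all of
    them. *)
Lemma generic_regular_along J xs s : is_ideal J ->
  {in s, forall f, sum_ideal J (in_span xs) f} -> regseq J s ->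
  regular_along (poly_ideal J) (Poly xs) (map polyC s).
Proof.
elim: s J => [|f s IH] J idJ xss //= [regf regs]; split.
  apply: generic_regular => //; apply: regular_no_socle regf => //.
  by apply: xss; rewrite inE eqxx.
rewrite -poly_ideal_adj //; apply: IH => //; first exact: adj_ideal.
move=> g gs; have [|a Ja xsa] := xss g; first by rewrite inE gs orbT.
by exists a => //; exact: sub_adj.
Qed.

End RegularSequences.

Lemma map_span (R : comNzRingType) (xs s : seq R) : {in s, forall f, in_span xs f} ->
  {in map polyC s, forall f, in_span (map polyC xs) f}.
Proof. by move=> xss _ /mapP[f fs ->]; apply: poly_span; exact: xss. Qed.

Lemma belast_span (R : comNzRingType) (xs : seq R) f0 s :
  {in f0 :: s, forall f, in_span xs f} -> {in belast f0 s, forall f, in_span xs f}.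
Proof. by move=> xss f /mem_belast; exact: xss. Qed.

(** Each generic step trades the generic element for the last entry of [s]. *)
Lemma regseq_grade_ge (R : comNzRingType) (J : R -> Prop) xs s : is_ideal J ->
  {in s, forall f, in_span xs f} -> regseq J s -> grade_ge (size s) J xs.
Proof.
move: {2}(size s) (erefl (size s)) => r.
elim: r R J xs s => [|r IH] R J xs [|f s] //= [sz] idJ xss [regf regs]; rewrite sz; split.
  by apply: (regular_no_socle idJ _ regf); apply: sum_ideal_subr => //; apply: xss; rewrite inE eqxx.
have idP := poly_ideal_ideal idJ.
rewrite -[r](_ : size (belast f%:P (map polyC s)) = r); last by rewrite size_belast size_map.
apply: IH.
- by rewrite size_belast size_map.
- exact: adj_ideal.
- by apply: belast_span; apply: (@map_span _ _ (f :: s)).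
apply: swap_regseq => //; first exact: (@poly_regseq _ _ (f :: s)).
apply: (@generic_regular_along _ _ _ (f :: s)) => // g gs.
  by apply: sum_ideal_subr => //; exact: xss.
Qed.

(** The uniqueness of the length of maximal regular sequences: the socle at the
    end survives every exchange with a generic element. *)
Lemma regseq_grade_eq (R : comNzRingType) (J : R -> Prop) xs s : is_ideal J ->
  {in s, forall f, in_span xs f} -> regseq J s -> has_socle (adjs J s) xs ->
  grade_eq (size s) J xs.
Proof.
move: {2}(size s) (erefl (size s)) => r.
elim: r R J xs s => [|r IH] R J xs [|f s] //= [sz] idJ xss [regf regs] soc; rewrite sz; split.
  by apply: (regular_no_socle idJ _ regf); apply: sum_ideal_subr => //; apply: xss; rewrite inE eqxx.
have idP := poly_ideal_ideal idJ.
rewrite -[r](_ : size (belast f%:P (map polyC s)) = r); last by rewrite size_belast size_map.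
apply: IH.
- by rewrite size_belast size_map.
- exact: adj_ideal.
- by apply: belast_span; apply: (@map_span _ _ (f :: s)).
- apply: swap_regseq => //; first exact: (@poly_regseq _ _ (f :: s)).
  apply: (@generic_regular_along _ _ _ (f :: s)) => // g gs.
  by apply: sum_ideal_subr => //; exact: xss.
apply: swap_socle => //.
- exact: (@poly_regseq _ _ (f :: s)).
- apply: (@generic_regular_along _ _ _ (f :: s)) => // g gs.
  by apply: sum_ideal_subr => //; exact: xss.
- exact: generic_span.
- exact: (@map_span _ _ (f :: s)).
have [u socu] := soc; exists u%:P.
rewrite -map_cons -(@poly_ideal_adjs _ _ (f :: s)) //.
by apply: poly_socle => //; exact: adjs_ideal (f :: s) idJ.
Qed.

(** * Grade of an intersection *)

(** Exactness of the sequence of [R/(A cap B)], [R/A + R/B] and [R/(A + B)] is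
    preserved modulo an element regular on the last term. *)
Lemma cap_adj (R : comNzRingType) (A B : R -> Prop) h :
  is_ideal A -> is_ideal B -> regular (sum_ideal A B) h ->
  cap_ideal (adj A h) (adj B h) = adj (cap_ideal A B) h.
Proof.
move=> idA idB regh; apply: pred_ext => p; split; last first.
  by case=> a [Aa Ba]; split; exists a.
case=> -[a Aa] [b Bb].
have [c Ac Bc] : sum_ideal A B (b - a).
  apply: regh; exists (p - a * h) => //.
  by rewrite (_ : _ - _ = - (p - b * h)); [exact: ideal_opp | ring].
exists (a + c); split.
  by rewrite (_ : _ - _ = (p - a * h) - h * c); [apply: ideal_sub => //; exact: ideal_mull | ring].
rewrite (_ : _ - _ = (p - b * h) + h * (b - a - c)); last by ring.
by apply: ideal_add => //; exact: ideal_mull.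
Qed.

(** The connecting map: a socle element [u] of [R/(A + B)] gives [h u = a + b],
    and [a] is a socle element modulo [A cap B] and [h]. *)
Lemma cap_socle (R : comNzRingType) (A B : R -> Prop) xs h :
  is_ideal A -> is_ideal B -> in_span xs h -> regular A h -> regular B h ->
  has_socle (sum_ideal A B) xs -> has_socle (adj (cap_ideal A B) h) xs.
Proof.
move=> idA idB xsh regA regB [u [nSu Su]].
have idS := sum_ideal_ideal idA idB.
have [a Aa Ba] : sum_ideal A B (h * u) by exact: (span_colon idS xsh).
exists a; split.
  case=> w [Aw Bw]; apply: nSu; exists w.
    apply: regA; rewrite (_ : _ * _ = a - (a - w * h)); last by ring.
    exact: ideal_sub.
  apply: regB; rewrite (_ : _ * _ = (h * u - a) + (a - w * h)); last by ring.
  exact: ideal_add.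
move=> x /Su[c Ac Bc]; exists c; split.
  by apply: ideal_sub => //; [exact: ideal_mull | exact: ideal_mulr].
rewrite (_ : _ - _ = h * (x * u - c) - x * (h * u - a)); last by ring.
by apply: ideal_sub => //; exact: ideal_mull.
Qed.

Lemma grade_eq_cap r (R : comNzRingType) (A B : R -> Prop) xs :
  is_ideal A -> is_ideal B -> grade_ge r.+1 A xs -> grade_ge r.+1 B xs ->
  grade_eq r (sum_ideal A B) xs -> grade_eq r.+1 (cap_ideal A B) xs.
Proof.
elim: r R A B xs => [|r IH] R A B xs idA idB [nosA geA] [nosB geB] eqr.
all: split; first by move=> u Cu; split; [apply: nosA | apply: nosB] => x /Cu[].
all: have [idA' idB'] := (poly_ideal_ideal idA, poly_ideal_ideal idB).
all: have regA := generic_regular idA nosA.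
all: have regB := generic_regular idB nosB.
all: have idS := sum_ideal_ideal idA idB; rewrite poly_ideal_cap.
  apply: cap_socle => //; first exact: generic_span.
  rewrite -poly_ideal_sum //; have [u socu] := eqr.
  by exists u%:P; exact: poly_socle.
case: eqr => nosS eqr.
have := generic_regular idS nosS; rewrite poly_ideal_sum // => regS.
rewrite -cap_adj //.
apply: IH => //; try exact: adj_ideal.
by rewrite sum_adj // -poly_ideal_sum.
Qed.

(** * Regular sequences as long as the list of generators *)

(** The product ideal [(xs) J]. *)
Definition mul_span (R : comNzRingType) (J : R -> Prop) (xs : seq R) : R -> Prop :=
  fun p => forall I : R -> Prop, is_ideal I ->
    (forall x j : R, x \in xs -> J j -> I (x * j)) -> I p.

Lemma mul_span_ideal (R : comNzRingType) (J : R -> Prop) xs : is_ideal (mul_span J xs).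
Proof.
split=> [|p q Jp Jq|a p Jp] I idI IJ; first exact: ideal_zero.
  by apply: ideal_add => //; [exact: Jp | exact: Jq].
by apply: ideal_mull => //; exact: Jp.
Qed.

Lemma mem_mul_span (R : comNzRingType) (J : R -> Prop) xs x j :
  x \in xs -> J j -> mul_span J xs (x * j).
Proof. by move=> xsx Jj I idI; exact. Qed.

Lemma span_ideal (R : comNzRingType) (xs : seq R) : is_ideal (in_span xs).
Proof.
split=> [|p q Jp Jq|a p Jp] I idI IJ; first exact: ideal_zero.
  by apply: ideal_add => //; [exact: Jp | exact: Jq].
by apply: ideal_mull => //; exact: Jp.
Qed.

Lemma span_adjs (R : comNzRingType) (xs : seq R) : in_span xs = adjs (@zero_ideal R) xs.
Proof.
apply: pred_ext => f; split=> [xsf|].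
  by apply: xsf => [|x]; [exact/adjs_ideal/zero_ideal_ideal | exact/mem_adjs/zero_ideal_ideal].
apply: adjs_min; [exact: zero_ideal_ideal | exact: span_ideal | |].
  by move=> _ ->; apply: ideal_zero; exact: span_ideal.
by move=> x; exact: mem_span.
Qed.

Lemma span_cons (R : comNzRingType) (xs : seq R) x :
  in_span (x :: xs) = adj (in_span xs) x.
Proof. by rewrite !span_adjs -adjs_adj. Qed.

Lemma mul_span_sub (R : comNzRingType) (J : R -> Prop) xs p :
  is_ideal J -> mul_span J xs p -> J p.
Proof. by move=> idJ; apply=> // x j _ Jj; exact: ideal_mull. Qed.

Lemma span_mul_span (R : comNzRingType) (J : R -> Prop) xs h j :
  in_span xs h -> J j -> mul_span J xs (h * j).
Proof.
move=> xsh Jj I idI IJ; apply: (xsh (fun x => I (x * j))) => [|x xsx]; last exact: IJ.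
split=> [|p q|a p]; first by rewrite mul0r; exact: ideal_zero.
  by rewrite mulrDl; exact: ideal_add.
by rewrite -mulrA; exact: ideal_mull.
Qed.

(** When a regular sequence in [(xs)] has as many entries as [xs], the first
    Tor of [R/J] against [R/(xs)] vanishes: [J cap (xs)] is [(xs) J].  The generic
    element [h = x0 + t (...)] has the first generator as constant term, so
    modulo [h] that generator becomes redundant, and the induction is on the
    number of generators. *)
Lemma regseq_full (R : comNzRingType) (J : R -> Prop) (xs s : seq R) :
  is_ideal J -> size s = size xs -> {in s, forall f, sum_ideal J (in_span xs) f} ->
  regseq J s -> forall p, J p -> in_span xs p -> mul_span J xs p.
Proof.
move: {2}(size xs) (erefl (size xs)) => n.
elim: n R J xs s => [|n IH] R J [|x0 xs] //= s.
  move=> _ _ _ _ _ p _ /(_ (@zero_ideal R)) -> //; last exact: zero_ideal_ideal.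
  by apply: ideal_zero; exact: mul_span_ideal.
case: s => [|f0 s] // [szxs] idJ [sz] xss regs p Jp xsp.
set h := Poly (x0 :: xs); have hE : h = x0%:P + 'X * Poly xs.
  by rewrite /h /= cons_poly_def mulrC addrC.
have idP := poly_ideal_ideal idJ; set J' := adj (poly_ideal J) h.
have idJ' : is_ideal J' by exact: adj_ideal.
have spanh : in_span (map polyC (x0 :: xs)) h by exact: generic_span.
have regh := generic_regular_along idJ xss regs.
have span' : in_span (map polyC xs) ('X * Poly xs).
  by apply: (ideal_mull (span_ideal _)); exact: generic_span.
have xss' : {in map polyC (f0 :: s), forall f, sum_ideal J' (in_span (map polyC xs)) f}.
  move=> _ /mapP[f fs ->]; have [a Ja xsa] := xss f fs.
  set I := sum_ideal _ _; have idI : is_ideal I.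
    by apply: sum_ideal_ideal => //; exact: span_ideal.
  rewrite -[f](subrKC a) polyCD; apply: (ideal_add idI).
    apply: sum_ideal_subl; first exact: span_ideal.
    by apply: sub_adj; rewrite poly_idealC.
  have xsI q : in_span (map polyC xs) q -> I q by exact: sum_ideal_subr.
  apply: (poly_span xsa) => // _ /mapP[x xsx ->]; move: xsx; rewrite inE.
  case/predU1P=> [->|xsx]; last by apply: xsI; apply: mem_span; exact: map_f.
  rewrite -[x0%:P](addrK ('X * Poly xs)) -hE; apply: (ideal_sub idI); last exact: xsI.
  by apply: sum_ideal_subl; [exact: span_ideal | exact: gen_adj].
have key q : J' q -> in_span (map polyC xs) q -> mul_span J' (map polyC xs) q.
  apply: (IH _ J' _ (belast f0%:P (map polyC s))) => //.
  - by rewrite size_map.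
  - by rewrite size_belast !size_map.
  - by move=> f /mem_belast; exact: xss'.
  - by apply: swap_regseq regh => //; exact: (@poly_regseq _ _ (f0 :: s)).
(* trade the x0-component of p for a multiple of h, then apply the induction *)
have [a xsa] : adj (in_span (map polyC xs)) x0%:P p%:P.
  by rewrite -span_cons; exact: (poly_span xsp).
have [w Jw] : adj (mul_span (poly_ideal J) (map polyC xs)) h (p%:P - a * h).
  apply: key.
  - apply: ideal_sub => //; first by apply: sub_adj; rewrite poly_idealC.
    exact: mem_adj.
  - rewrite hE (_ : _ - _ = (p%:P - a * x0%:P) - a * ('X * Poly xs)); last by ring.
    by apply: (ideal_sub (span_ideal _)) => //; exact: (ideal_mull (span_ideal _)).
  - by apply: adj_ideal; exact: mul_span_ideal.
  move=> x j xsx [b Jb]; exists (x * b).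
  by rewrite -mulrA -mulrBr; exact: mem_mul_span.
have Jaw : poly_ideal J (a + w).
  have [reg0 _] := regh; apply: reg0; rewrite -/h.
  rewrite (_ : _ * _ = p%:P - (p%:P - a * h - w * h)); last by ring.
  apply: (ideal_sub idP); first by rewrite poly_idealC.
  exact: mul_span_sub Jw.
have Jp' : mul_span (poly_ideal J) (map polyC (x0 :: xs)) p%:P.
  rewrite (_ : p%:P = (p%:P - a * h - w * h) + h * (a + w)); last by ring.
  apply: (ideal_add (mul_span_ideal _ _)); last exact: span_mul_span.
  move: Jw; apply; first exact: mul_span_ideal.
  by move=> x j xsx; apply: mem_mul_span; rewrite inE xsx orbT.
(* descend from R[t] to R by reading coefficients *)
have := Jp' (poly_ideal (mul_span J (x0 :: xs))).
rewrite poly_idealC; last exact: mul_span_ideal.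
apply; first exact/poly_ideal_ideal/mul_span_ideal.
move=> _ j /mapP[x xsx ->] Jj i; rewrite coefCM.
by apply: mem_mul_span.
Qed.

(** * Dickson's lemma and Noetherianity of polynomial rings *)

Lemma nat_least (P : nat -> Prop) : (exists k, P k) ->
  exists2 k, P k & forall l, P l -> (k <= l)%N.
Proof.
case=> k; elim/ltn_ind: k => k IH Pk.
case: (classic (exists2 l, (l < k)%N & P l)) => [[l ltlk Pl]|nP]; first exact: IH Pl.
exists k => // l Pl; rewrite leqNgt; apply/negP => ltlk.
by apply: nP; exists l.
Qed.

(** Choose repeatedly an index at which [g] is minimal on the remaining tail. *)
Lemma nondecreasing_subsequence (g : nat -> nat) : exists2 phi : nat -> nat,
  {homo phi : a b / (a < b)%N} & {homo g \o phi : a b / (a <= b)%N}.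
Proof.
have least N : exists i, (N <= i)%N /\ forall j, (N <= j)%N -> (g i <= g j)%N.
  have [|v [i leNi vE] minv] := nat_least (P := fun v => exists2 i, (N <= i)%N & v = g i).
    by exists (g N), N.
  by exists i; split=> // j leNj; rewrite -vE; apply: minv; exists j.
pose next N := epsilon (inhabits 0%N) (fun i => (N <= i)%N /\
  forall j, (N <= j)%N -> (g i <= g j)%N).
have nextP N : (N <= next N)%N /\ forall j, (N <= j)%N -> (g (next N) <= g j)%N.
  exact: (epsilon_spec (inhabits 0%N) _ (least N)).
pose phi := fix phi k := next (if k is k'.+1 then (phi k').+1 else 0%N).
have phiS k : (phi k < phi k.+1)%N by case: (nextP (phi k).+1).
exists phi; first by apply: homo_ltn phiS; exact: ltn_trans.
apply: homo_leq => [x|y x z|k /=]; [exact: leqnn | exact: leq_trans|].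
have [_] := nextP (if k is k'.+1 then (phi k').+1 else 0%N); rewrite -/phi.
have -> : next (if k is k'.+1 then (phi k').+1 else 0%N) = phi k by case: k.
apply; rewrite -/(phi k.+1); case: k => [|k] //=.
have h1 := phiS k; have h2 := phiS k.+1; exact: ltn_trans h1 h2.
Qed.

(** Refine the sequence one coordinate at a time until every exponent is
    nondecreasing. *)
Lemma dickson n (f : nat -> 'X_{1..n}) : exists i j, (i < j)%N /\ (f i <= f j)%MM.
Proof.
suff [phi phiM phiP] : exists2 phi : nat -> nat, {homo phi : a b / (a < b)%N} &
    forall c, c \in enum 'I_n -> forall a b, (a <= b)%N -> (f (phi a) c <= f (phi b) c)%N.
  exists (phi 0%N), (phi 1%N); split; first exact: phiM.
  by apply/mnm_lepP => c; apply: phiP; rewrite // mem_enum.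
elim: (enum 'I_n) => [|c cs [phi phiM phiP]]; first by exists id.
have [psi psiM psiP] := nondecreasing_subsequence (fun k => f (phi k) c).
exists (phi \o psi) => [a b ltab|d]; first exact/phiM/psiM.
rewrite inE => /predU1P[->|/phiP h] a b leab; first exact: psiP.
by apply: h; apply: (ltnW_homo psiM).
Qed.

(** The ascending chain condition, in the form of an induction principle. *)
Definition noetherian (R : comNzRingType) : Prop :=
  forall P : (R -> Prop) -> Prop,
    (forall J, is_ideal J ->
       (forall I, is_ideal I -> (forall p, J p -> I p) -> (exists2 p, I p & ~ J p) -> P I) ->
     P J) ->
  forall J, is_ideal J -> P J.

Section Division.
Variables (K : fieldType) (n : nat).
Local Notation T := {mpoly K[n]}.
Implicit Types (I J B : T -> Prop) (p q b : T) (m : 'X_{1..n}).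

Definition lead_mnm B m : Prop := exists b, [/\ B b, b != 0 & mlead b = m].

Definition standard B q : Prop := forall m, m \in msupp q -> ~ lead_mnm B m.

(** Cancel the leading term by an element of [B] when possible, and otherwise set
    it aside. *)
Lemma division B p : is_ideal B -> exists q, B (p - q) /\ standard B q.
Proof.
move=> idB; elim/mleadrect: p => p IH.
have [->|nzp] := eqVneq p 0.
  by exists 0; rewrite subrr; split; [exact: ideal_zero | move=> m; rewrite msupp0].
have drop r : (mlead r <= mlead p)%O -> r@_(mlead p) = 0 ->
    exists q, B (r - q) /\ standard B q.
  move=> ler r0; have [->|nzr] := eqVneq r 0.
    by exists 0; rewrite subrr; split; [exact: ideal_zero | move=> m; rewrite msupp0].
  apply: IH; rewrite lt_neqAle ler andbT.
  by apply: contraNneq nzr => eqm; rewrite -mleadc_eq0 eqm r0.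
have le_lead c q : (mlead q <= mlead p)%O -> (mlead (p - c *: q) <= mlead p)%O.
  move=> leq; apply: le_trans (mleadB_le _ _) _; rewrite leUx lexx /=.
  exact: le_trans (mleadZ_le _ _) leq.
have [[b [Bb nzb eqb]]|nlead] := classic (lead_mnm B (mlead p)).
  have nzc : mleadc b != 0 by rewrite mleadc_eq0.
  have [||q [Bq stq]] := drop (p - (mleadc p / mleadc b) *: b).
  - by apply: le_lead; rewrite eqb.
  - by rewrite mcoeffB mcoeffZ -eqb divfK // subrr.
  exists q; split=> //.
  rewrite (_ : p - q = (p - (mleadc p / mleadc b) *: b - q) + (mleadc p / mleadc b)%:MP * b).
    by apply: ideal_add => //; exact: ideal_mull.
  by rewrite mul_mpolyC addrAC subrK.
have [||q [Bq stq]] := drop (p - mleadc p *: 'X_[mlead p]).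
- by apply: le_lead; rewrite mleadXm.
- by rewrite mcoeffB mcoeffZ mcoeffX eqxx mulr1 subrr.
exists (q + mleadc p *: 'X_[mlead p]); split; first by rewrite opprD addrA addrAC.
move=> m /msuppD_le; rewrite mem_cat => /orP[/stq //|/msuppZ_le].
by rewrite msuppX inE => /eqP->.
Qed.

Lemma standard_eq0 B q : B q -> standard B q -> q = 0.
Proof.
move=> Bq stq; apply/eqP/negPn/negP => nzq.
by apply: (stq _ (mlead_supp nzq)); exists q.
Qed.

Lemma lead_mnm_dvd B m1 m2 : is_ideal B ->
  lead_mnm B m1 -> (m1 <= m2)%MM -> lead_mnm B m2.
Proof.
move=> idB [b [Bb nzb <-]] lem; exists ('X_[m2 - mlead b] * b).
have nzX : 'X_[m2 - mlead b] != 0 :> T by rewrite -msize_poly_eq0 msizeX.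
rewrite mulf_neq0 // mleadM // mleadXm submK //; split=> //.
exact: ideal_mull.
Qed.

Lemma lead_mnm_sub I J p : is_ideal I -> is_ideal J -> (forall q, I q -> J q) ->
  (forall m, lead_mnm J m -> lead_mnm I m) -> J p -> I p.
Proof.
move=> idI idJ IJ leadJI Jp; have [q [Iq stq]] := division p idI.
have Jq : J q by rewrite -(subKr p q); apply: ideal_sub => //; exact: IJ.
rewrite -(subr0 p) -(standard_eq0 Jq) // => m mq leadm.
by apply: (stq m mq); exact: leadJI.
Qed.

(** A strictly increasing chain of ideals has strictly increasing sets of
    leading monomials ([lead_mnm_sub]), which Dickson's lemma forbids. *)
Lemma mpoly_noetherian : noetherian T.
Proof.
move=> P step J idJ; apply: NNPP => nPJ.
pose bad I := is_ideal I /\ ~ P I.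
pose bigger I I' := [/\ bad I', forall p, I p -> I' p & exists m, lead_mnm I' m /\ ~ lead_mnm I m].
have ex_bigger I : bad I -> exists I', bigger I I'.
  move=> [idI nPI]; apply: NNPP => none; apply: nPI; apply: step => // I' idI' II' [p I'p nIp].
  apply: NNPP => nPI'; apply: none; exists I'; split=> //.
  apply: NNPP => nolead; apply: nIp; apply: (lead_mnm_sub idI idI') => // m leadm.
  by apply: NNPP => nleadm; apply: nolead; exists m.
pose next I := epsilon (inhabits I) (bigger I).
have nextP I : bad I -> bigger I (next I).
  by move=> badI; exact: (epsilon_spec (inhabits I) _ (ex_bigger I badI)).
pose chain k := iter k next J.
have badc k : bad (chain k) by elim: k => [|k /nextP[]].
have chainS i j : (i <= j)%N -> forall p, chain i p -> chain j p.
  move=> /subnK<- p; elim: (j - i)%N => [|k IHk] // /IHk ck.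
  by case: (nextP _ (badc (k + i)%N)) => _ sub _; exact: sub.
pose f k := epsilon (inhabits 0%MM) (fun m => lead_mnm (chain k.+1) m /\ ~ lead_mnm (chain k) m).
have fP k : lead_mnm (chain k.+1) (f k) /\ ~ lead_mnm (chain k) (f k).
  by case: (nextP _ (badc k)) => _ _; exact: epsilon_spec.
have [i [j [ltij lef]]] := dickson f.
case: (fP j) => _; apply; apply: lead_mnm_dvd lef; first by case: (badc j).
have [[b [cb nzb eqb]] _] := fP i; exists b; split=> //.
exact: chainS cb.
Qed.

End Division.

(** * Existence of maximal regular sequences *)

Section RegularElements.
Variable R : comNzRingType.
Hypothesis noethR : noetherian R.
Variables (J : R -> Prop) (xs : seq R).
Hypothesis idJ : is_ideal J.
Implicit Types (I : R -> Prop) (us : seq R) (a b p u v w : R).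

Definition ann_sub u v : Prop := forall p, J (p * u) -> J (p * v).

(** [(J : u)] is maximal among the annihilators of nonzero elements of [R/J].
    These are primes, and they cover the zero divisors of [R/J]. *)
Definition max_ann u : Prop := ~ J u /\
  forall v, ~ J v -> ann_sub u v -> ann_sub v u.

Lemma colon_ideal u : is_ideal (fun p => J (p * u)).
Proof.
split=> [|p q|a p]; first by rewrite mul0r; exact: ideal_zero.
  by rewrite mulrDl; exact: ideal_add.
by rewrite -mulrA; exact: ideal_mull.
Qed.

Lemma ex_max_ann v : ~ J v -> exists2 u, max_ann u & ann_sub v u.
Proof.
suff H I : is_ideal I -> forall v, (forall p, I p <-> J (p * v)) ->
    ~ J v -> exists2 u, max_ann u & ann_sub v u.
  exact: (H _ (colon_ideal v)).
move=> idI; move: I idI; apply: noethR => I idI IH {}v Iv nJv.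
have [maxv|nmax] := classic (max_ann v); first by exists v.
have [w [nJw vw nwv]] : exists w, [/\ ~ J w, ann_sub v w & ~ ann_sub w v].
  apply: NNPP => none; apply: nmax; split=> // w nJw vw.
  by apply: NNPP => nwv; apply: none; exists w.
have Iw p : I p -> J (p * w) by move=> /Iv/vw.
have strict : exists2 p, J (p * w) & ~ I p.
  apply: NNPP => none; apply: nwv => p Jpw; apply: NNPP => nJpv.
  by apply: none; exists p => // /Iv.
have [u maxu wu] := IH _ (colon_ideal w) Iw strict w (fun p => iff_refl _) nJw.
by exists u => // p /vw/wu.
Qed.

Lemma max_ann_prime u a b : max_ann u -> J (a * b * u) -> J (a * u) \/ J (b * u).
Proof.
move=> [nJu maxu] Jabu; have [|nJbu] := classic (J (b * u)); [by right | left].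
apply: (maxu (b * u)) => //; last by rewrite mulrA.
by move=> p Jpu; rewrite mulrCA; exact: ideal_mull.
Qed.

(** Since [(J : v)] is prime, a product of elements witnessing the
    non-inclusions stays outside it. *)
Lemma ann_separation us v : max_ann v -> {in us, forall u, ~ ann_sub u v} ->
  exists b, ~ J (b * v) /\ {in us, forall u, J (b * u)}.
Proof.
move=> maxv; elim: us => [|u us IH] sep; first by exists 1; rewrite mul1r; case: maxv.
have [|b [nJbv Jbus]] := IH; first by move=> w wus; apply: sep; rewrite inE wus orbT.
have [a Jau nJav] : exists2 a, J (a * u) & ~ J (a * v).
  apply: NNPP => none; apply: (sep u); first by rewrite inE eqxx.
  by move=> p Jpu; apply: NNPP => nJpv; apply: none; exists p.
exists (a * b); split; first by case/(max_ann_prime maxv).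
move=> w; rewrite inE => /predU1P[->|/Jbus Jbw].
  by rewrite [a * b]mulrC -mulrA; exact: ideal_mull.
by rewrite -mulrA; exact: ideal_mull.
Qed.

(** If the listed annihilators miss a maximal one [(J : v)], some [b] kills the
    listed [us] but not [v], so [v] is not in [J + (us)].  Enlarging the list
    therefore enlarges that ideal, and the process stops. *)
Lemma max_ann_finite : exists us, {in us, forall u, max_ann u} /\
  forall v, max_ann v -> exists2 u, u \in us & ann_sub v u.
Proof.
suff H I : is_ideal I -> forall us, I = adjs J us -> {in us, forall u, max_ann u} ->
    exists us, {in us, forall u, max_ann u} /\
      forall v, max_ann v -> exists2 u, u \in us & ann_sub v u.
  exact: (H J idJ [::]).
move=> idI; move: I idI; apply: noethR => I idI IH us IE maxus.
have [cover|ncover] := classic (forall v, max_ann v -> exists2 u, u \in us & ann_sub v u).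
  by exists us.
have [v maxv nv] : exists2 v, max_ann v & forall u, u \in us -> ~ ann_sub v u.
  apply: NNPP => none; apply: ncover => v maxv; apply: NNPP => nv.
  by apply: none; exists v => // u uus vu; apply: nv; exists u.
have [u uus uv|b [nJbv Jbus]] := ann_separation (us := us) maxv.
  by case: (maxus u uus) => nJu maxu; apply: (nv u uus); apply: maxu => //; case: maxv.
apply: (IH (adjs J (v :: us)) _ _ _ (v :: us)) => //.
- exact: (adjs_ideal (v :: us) idJ).
- by move=> p; rewrite IE /= adjs_adj; exact: sub_adj.
- exists v; first by apply: mem_adjs => //; rewrite inE eqxx.
  rewrite IE => Iv; apply: nJbv.
  have idb : is_ideal (fun p => J (b * p)).
    split=> [|p q|a p]; first by rewrite mulr0; exact: ideal_zero.
      by rewrite mulrDr; exact: ideal_add.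
    by rewrite mulrCA; exact: ideal_mull.
  by apply: (adjs_min idJ idb _ _ Iv) => // p Jp; exact: ideal_mull.
by move=> u; rewrite inE => /predU1P[->|/maxus].
Qed.

(** Prime avoidance, with the list extended one prime at a time: if [h] avoids
    the old primes but not the new one, add a multiple of a generator that lies
    in all old primes and outside the new one. *)
Lemma avoid_max_ann us : no_socle J xs -> {in us, forall u, max_ann u} ->
  exists2 h, in_span xs h & {in us, forall u, ~ J (h * u)}.
Proof.
move=> nos; elim: us => [|u us IH] maxus.
  by exists 0 => //; apply: ideal_zero; exact: span_ideal.
have maxu : max_ann u by apply: maxus; rewrite inE eqxx.
have [|h xsh avoid] := IH; first by move=> w wus; apply: maxus; rewrite inE wus orbT.
have [Jhu|nJhu] := classic (J (h * u)); last first.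
  by exists h => // w; rewrite inE => /predU1P[->|/avoid].
have [x xsx nJxu] : exists2 x, x \in xs & ~ J (x * u).
  apply: NNPP => none; case: (maxu) => nJu _; apply: nJu; apply: nos => x xsx.
  by apply: NNPP => nJxu; apply: none; exists x.
have [w wus wu|b [nJbu Jbus]] := ann_separation (us := us) maxu.
  have [|_ maxw] := maxus w; first by rewrite inE wus orbT.
  by apply: (avoid w wus); exact: (maxw u (proj1 maxu) wu h Jhu).
exists (h + b * x).
  by apply: (ideal_add (span_ideal _)) => //; apply: (ideal_mull (span_ideal _)); exact: mem_span.
move=> w; rewrite inE mulrDl => /predU1P[->|wus] Jsum.
  have Jbxu : J (b * x * u).
    by rewrite -[b * x * u](addrK (h * u)) [b * x * u + _]addrC; exact: ideal_sub.
  by case: (max_ann_prime maxu Jbxu).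
apply: (avoid w wus); rewrite -[h * w](addrK (b * x * w)); apply: ideal_sub => //.
by rewrite [b * x]mulrC -mulrA; apply: ideal_mull => //; exact: Jbus.
Qed.

Lemma ex_regular : no_socle J xs -> exists2 h, in_span xs h & regular J h.
Proof.
move=> nos; have [us [maxus cover]] := max_ann_finite.
have [h xsh avoid] := avoid_max_ann nos maxus.
exists h => // v Jhv; apply: NNPP => nJv.
have [u maxu vu] := ex_max_ann nJv.
have [w wus uw] := cover u maxu.
by apply: (avoid w wus); apply/uw/vu.
Qed.

End RegularElements.

(** Properness of [(xs)] makes every further regular element enlarge the ideal,
    so the extension of a regular sequence terminates. *)
Lemma ex_maximal_regseq (R : comNzRingType) (J : R -> Prop) (xs : seq R) :
  noetherian R -> ~ in_span xs 1 -> is_ideal J -> (forall p, J p -> in_span xs p) ->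
  exists s, [/\ {in s, forall f, in_span xs f}, regseq J s & has_socle (adjs J s) xs].
Proof.
move=> noethR n1 idJ; move: J idJ; apply: (noethR) => J idJ IH Jxs.
have [soc|/has_socleN nos] := classic (has_socle J xs); first by exists [::].
have [h xsh regh] := ex_regular noethR idJ nos.
have idJh := adj_ideal idJ h.
have strict : exists2 p, adj J h p & ~ J p.
  exists h; first exact: gen_adj.
  by move=> Jh; apply: n1; apply: Jxs; apply: regh; rewrite mulr1.
have [s [xss regs soc]] := IH _ idJh (@sub_adj _ _ _) strict (adj_min (span_ideal xs) Jxs xsh).
exists (h :: s); split=> // f; rewrite inE => /predU1P[->|/xss] //.
Qed.

(** * Normal forms and tensor products *)

Section NormalForm.
Variables (K : fieldType) (n : nat) (B : {mpoly K[n]} -> Prop).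
Hypothesis idB : is_ideal B.
Implicit Types (p q : {mpoly K[n]}).

(** The representative of [p] modulo [B] whose monomials are not leading
    monomials of [B]; those monomials form a [K]-basis of the quotient. *)
Definition normal_form p : {mpoly K[n]} :=
  epsilon (inhabits 0) (fun q => B (p - q) /\ standard B q).

Lemma normal_formP p : B (p - normal_form p) /\ standard B (normal_form p).
Proof. exact: (epsilon_spec (inhabits 0) _ (division p idB)). Qed.

Lemma normal_form_unique p q : B (p - q) -> standard B q -> normal_form p = q.
Proof.
move=> Bpq stq; have [Bpn stn] := normal_formP p.
apply/eqP; rewrite -subr_eq0; apply/eqP; apply: (@standard_eq0 _ _ B).
  rewrite (_ : _ - _ = (p - q) - (p - normal_form p)); last by ring.
  exact: ideal_sub.
by move=> w /msuppB_le; rewrite mem_cat => /orP[/stn|/stq].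
Qed.

Lemma normal_form_linear : linear normal_form.
Proof.
move=> c p q; have [Bp stp] := normal_formP p; have [Bq stq] := normal_formP q.
apply: normal_form_unique; last first.
  by move=> w /msuppD_le; rewrite mem_cat => /orP[/msuppZ_le/stp|/stq].
rewrite -!mul_mpolyC (_ : _ - _ = c%:MP * (p - normal_form p) + (q - normal_form q)); last by ring.
by apply: ideal_add => //; exact: ideal_mull.
Qed.

Lemma normal_form_eq0 p : normal_form p = 0 <-> B p.
Proof.
split=> [nf0|Bp]; first by have [] := normal_formP p; rewrite nf0 subr0.
by apply: normal_form_unique; rewrite ?subr0 // => w; rewrite msupp0.
Qed.

Definition normal_coef w p : K^o := (normal_form p)@_w.

Lemma normal_coef_linear w : linear (normal_coef w).
Proof. by move=> c p q; rewrite /normal_coef normal_form_linear mcoeffD mcoeffZ. Qed.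

End NormalForm.

Section LinearMaps.
Variables (K : fieldType) (n : nat) (V : lmodType K).
Implicit Types (f g : {mpoly K[n]} -> V).

Lemma linear_lincomb f (I : Type) (r : seq I) (c : I -> K) (F : I -> {mpoly K[n]}) :
  linear f -> f (\sum_(i <- r) c i *: F i) = \sum_(i <- r) c i *: f (F i).
Proof.
move=> linf; elim: r => [|i r IH]; last by rewrite !big_cons linf IH.
rewrite !big_nil; have := linf (-1) 0 0.
by rewrite scaler0 addr0 scaleN1r addNr.
Qed.

Lemma linear_monomials f g : linear f -> linear g ->
  (forall w, f 'X_[w] = g 'X_[w]) -> f =1 g.
Proof.
move=> linf ling fg p; rewrite [p]mpolyE !linear_lincomb //.
by apply: eq_bigr => w _; rewrite fg.
Qed.

End LinearMaps.

(** A polynomial ring in [N] variables seen as the tensor product of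
    polynomial rings in [n] and [m] variables: [lp], [rp] project exponents to
    the two groups of variables, [jl], [jr] embed them.  The setting is
    symmetric, so that every result can be used with the factors exchanged. *)

Section Tensor.
Variables (K : fieldType) (n m N : nat).
Local Notation S1 := {mpoly K[n]}.
Local Notation S2 := {mpoly K[m]}.
Local Notation S := {mpoly K[N]}.
Variables (lp : 'X_{1..N} -> 'X_{1..n}) (rp : 'X_{1..N} -> 'X_{1..m}).
Variables (jl : 'X_{1..n} -> 'X_{1..N}) (jr : 'X_{1..m} -> 'X_{1..N}).
Variables (il : {lrmorphism S1 -> S}) (ir : {lrmorphism S2 -> S}).
Hypothesis ilX : forall u, il 'X_[u] = 'X_[jl u].
Hypothesis irX : forall v, ir 'X_[v] = 'X_[jr v].
Hypothesis lp_jl : forall u w, lp (jl u + w)%MM = (u + lp w)%MM.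
Hypothesis rp_jl : forall u w, rp (jl u + w)%MM = rp w.
Hypothesis lp_jr : forall v w, lp (jr v + w)%MM = lp w.
Hypothesis rp_jr : forall v w, rp (jr v + w)%MM = (v + rp w)%MM.
Hypothesis split_mnm : forall w, w = (jl (lp w) + jr (rp w))%MM.

Definition ext_ideal (k : nat) (f : {mpoly K[k]} -> S) (A : {mpoly K[k]} -> Prop) : S -> Prop :=
  ideal_gen (fun q => exists2 p, A p & q = f p).

Section Slice.
Variable lam : S2 -> K^o.
Hypothesis lamL : linear lam.

(** The map [id (x) lam], from the tensor product to the first factor. *)
Definition slice (p : S) : S1 :=
  \sum_(w <- msupp p) (p@_w * lam 'X_[rp w]) *: 'X_[lp w].

Lemma slicewE k p : (msize p <= k)%N ->
  slice p = \sum_(w : 'X_{1..N < k}) (p@_w * lam 'X_[rp w]) *: 'X_[lp w].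
Proof.
move=> lek; pose I : subFinType _ := 'X_{1..N < k}.
rewrite /slice (ssrcomplements.big_mksub I) ?msupp_uniq //=; last first.
  by move=> x /msize_mdeg_lt /leq_trans; apply.
rewrite big_rmcond //= => j /memN_msupp_eq0 ->.
by rewrite mul0r scale0r.
Qed.

Lemma slice_linear : linear slice.
Proof.
move=> c p q; pose k := maxn (msize (c *: p + q)) (maxn (msize p) (msize q)).
rewrite !(@slicewE k) ?leq_max ?leqnn ?orbT // scaler_sumr -big_split /=.
apply: eq_bigr => w _; rewrite scalerA -scalerDl mcoeffD mcoeffZ.
by congr (_ *: _); ring.
Qed.

Lemma sliceX w : slice 'X_[w] = lam 'X_[rp w] *: 'X_[lp w].
Proof. by rewrite /slice msuppX big_seq1 mcoeffX eqxx mul1r. Qed.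

Lemma slice_il f p : slice (il f * p) = f * slice p.
Proof.
move: f; apply: linear_monomials.
- by move=> c f g; rewrite linearP mulrDl -scalerAl slice_linear.
- by move=> c f g; rewrite mulrDl -scalerAl.
move=> u; move: p; apply: linear_monomials.
- by move=> c p q; rewrite mulrDr -scalerAr slice_linear.
- by move=> c p q; rewrite slice_linear mulrDr -scalerAr.
by move=> w; rewrite ilX -mpolyXD !sliceX rp_jl lp_jl -scalerAr -mpolyXD.
Qed.

Lemma slice_ir g w : slice (ir g * 'X_[w]) = lam (g * 'X_[rp w]) *: 'X_[lp w].
Proof.
move: g; apply: linear_monomials.
- by move=> c f g; rewrite linearP mulrDl -scalerAl slice_linear.
- by move=> c f g; rewrite mulrDl -scalerAl lamL scalerDl -scalerA.
by move=> v; rewrite irX -!mpolyXD sliceX rp_jr lp_jr.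
Qed.

Lemma slice_ir0 (B : S2 -> Prop) g p : is_ideal B -> (forall b, B b -> lam b = 0) ->
  B g -> slice (ir g * p) = 0.
Proof.
move=> idB lamB Bg; rewrite [p]mpolyE mulr_sumr.
under eq_bigr do rewrite -scalerAr.
rewrite linear_lincomb; last exact: slice_linear.
rewrite big1 // => w _; rewrite slice_ir lamB ?scale0r ?scaler0 //.
exact: ideal_mulr.
Qed.

End Slice.

Variables (A : S1 -> Prop) (B : S2 -> Prop).
Hypotheses (idA : is_ideal A) (idB : is_ideal B).
Let Ae := ext_ideal il A.
Let Be := ext_ideal ir B.

Lemma ext_ideal_ideal k (f : {mpoly K[k]} -> S) C : is_ideal (ext_ideal f C).
Proof. exact: ideal_gen_ideal. Qed.

Lemma mem_ext k (f : {mpoly K[k]} -> S) (C : {mpoly K[k]} -> Prop) p :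
  C p -> ext_ideal f C (f p).
Proof. by move=> Cp; apply: mem_ideal_gen; exists p. Qed.

Let nfc := normal_coef B.

Let nfL w : linear (nfc w). Proof. exact: normal_coef_linear. Qed.

(** Expanding the second factor along the basis of standard monomials modulo
    [B], membership in the sum of the extended ideals is membership in [A] of
    every coordinate. *)
Lemma tensor_mem p : sum_ideal Ae Be p <-> forall w, A (slice (nfc w) p).
Proof.
have idAe : is_ideal Ae by exact: ext_ideal_ideal.
have idBe : is_ideal Be by exact: ext_ideal_ideal.
have idS := sum_ideal_ideal idAe idBe.
have nfB w b : B b -> nfc w b = 0.
  by move=> /(normal_form_eq0 idB) nf0; rewrite /nfc /normal_coef nf0 mcoeff0.
split=> [[a Aa Bpa] w|Asl].
  have sl_ideal : is_ideal (fun q => forall p, A (slice (nfc w) (q * p))).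
    split=> [q|q r Aq Ar t|c q Aq t].
    - by rewrite mul0r /slice msupp0 big_nil; exact: ideal_zero.
    - rewrite mulrDl -[q * t]scale1r slice_linear // scale1r.
      by apply: ideal_add.
    - by rewrite [c * q]mulrC -mulrA.
  have slA : forall q, Ae q -> forall t, A (slice (nfc w) (q * t)).
    apply: (ideal_gen_min sl_ideal) => _ [f Af ->] t.
    by rewrite slice_il //; exact: ideal_mulr.
  have slB : forall q, Be q -> forall t, A (slice (nfc w) (q * t)).
    apply: (ideal_gen_min sl_ideal) => _ [g Bg ->] t.
    by rewrite (slice_ir0 (nfL w) (B := B)) //; [exact: ideal_zero | exact: nfB].
  have := ideal_add idA (slA a Aa 1) (slB _ Bpa 1).
  by rewrite !mulr1 -[slice _ a]scale1r -slice_linear // scale1r subrKC.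
pose k := \max_(w <- msupp p) msize (normal_form B 'X_[rp w]).
have pE : p = \sum_(w <- msupp p) p@_w *: (il 'X_[lp w] * ir 'X_[rp w]).
  rewrite {1}[p]mpolyE; apply: eq_bigr => w _; congr (_ *: _).
  by rewrite ilX irX -mpolyXD -split_mnm.
pose q := \sum_(w <- msupp p) p@_w *: (il 'X_[lp w] * ir (normal_form B 'X_[rp w])).
have Spq : sum_ideal Ae Be (p - q).
  apply: sum_ideal_subr => //; rewrite {1}pE /q -sumrB.
  apply: (ideal_sum idBe) => w _; rewrite -scalerBr -mulrBr -rmorphB -mul_mpolyC.
  apply: (ideal_mull idBe); apply: (ideal_mull idBe); apply: mem_ext.
  by case: (normal_formP idB 'X_[rp w]).
rewrite -(subrK q p); apply: (ideal_add idS) => //.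
(* k bounds the degrees of all the normal forms in q, so their standard
   expansions can be collected by monomials of the second factor *)
have -> : q = \sum_(v : 'X_{1..m < k}) il (slice (nfc v) p) * ir 'X_[v].
  rewrite /q big_seq.
  under eq_bigr => w wp.
    rewrite [normal_form B _](@mpolywE _ _ k); last first.
      by rewrite /k (big_rem w) //= leq_max leqnn.
    rewrite linear_sum mulr_sumr scaler_sumr.
    over.
  rewrite -big_seq exchange_big /=; apply: eq_bigr => v _.
  rewrite /slice linear_sum mulr_suml; apply: eq_bigr => w _.
  by rewrite !linearZ /= -scalerAr -scalerAl scalerA.
apply: (ideal_sum idS) => v _; apply: sum_ideal_subl => //.
by apply: (ideal_mulr idAe); apply: mem_ext.
Qed.

(** Coordinates are linear over the first factor. *)
Lemma tensor_regular f : regular A f -> regular (sum_ideal Ae Be) (il f).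
Proof.
move=> regf p /tensor_mem Sfp; apply/tensor_mem => w; apply: regf.
by have := Sfp w; rewrite slice_il.
Qed.

(** Some coordinate of the class of [v] is a nonzero scalar, and it multiplies
    [u]. *)
Lemma tensor_mul_notin u v : ~ A u -> ~ B v -> ~ sum_ideal Ae Be (il u * ir v).
Proof.
move=> nAu nBv /tensor_mem Suv; apply: nBv; apply/(normal_form_eq0 idB)/mpolyP => w.
rewrite mcoeff0; apply/eqP/negPn/negP => nzw; apply: nAu.
have := Suv w; rewrite slice_il // -[ir v]mulr1 -mpolyX0 slice_ir //.
have [lp0 rp0] : lp 0%MM = 0%MM /\ rp 0%MM = 0%MM.
  have jl0 : jl (lp 0%MM) = 0%MM.
    by apply/eqP; have /eqP := split_mnm 0%MM; rewrite eq_sym mnmD_eq0 => /andP[].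
  have jr0 : jr (rp 0%MM) = 0%MM.
    by apply/eqP; have /eqP := split_mnm 0%MM; rewrite eq_sym mnmD_eq0 => /andP[].
  split.
    have := lp_jl (lp 0%MM) 0%MM; rewrite jl0 addm0 -{1}[lp 0%MM]add0m => /eqP.
    by rewrite eqm_add2r => /eqP/esym.
  have := rp_jr (rp 0%MM) 0%MM; rewrite jr0 addm0 -{1}[rp 0%MM]add0m => /eqP.
  by rewrite eqm_add2r => /eqP/esym.
rewrite lp0 rp0 !mpolyX0 mulr1 -scalerAr mulr1 => Anu.
rewrite -[u](scalerK (a := nfc w v)) // -mul_mpolyC.
exact: ideal_mull.
Qed.

Lemma ext_adj k (f : {lrmorphism {mpoly K[k]} -> S}) C a : is_ideal C ->
  ext_ideal f (adj C a) = adj (ext_ideal f C) (f a).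
Proof.
move=> idC; apply: pred_ext => p; split.
  apply: ideal_gen_min; first exact/adj_ideal/ext_ideal_ideal.
  by move=> _ [q [b Cb] ->]; exists (f b); rewrite -rmorphM -rmorphB; exact: mem_ext.
apply: adj_min; first exact: ext_ideal_ideal.
  apply: ideal_gen_min; first exact: ext_ideal_ideal.
  by move=> _ [q Cq ->]; apply: mem_ext; exact: sub_adj.
by apply: mem_ext; exact: gen_adj.
Qed.

End Tensor.

Section TensorSequences.
Variables (K : fieldType) (n m N : nat).
Variables (lp : 'X_{1..N} -> 'X_{1..n}) (rp : 'X_{1..N} -> 'X_{1..m}).
Variables (jl : 'X_{1..n} -> 'X_{1..N}) (jr : 'X_{1..m} -> 'X_{1..N}).
Variables (il : {lrmorphism {mpoly K[n]} -> {mpoly K[N]}}).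
Variables (ir : {lrmorphism {mpoly K[m]} -> {mpoly K[N]}}).
Hypothesis ilX : forall u, il 'X_[u] = 'X_[jl u].
Hypothesis irX : forall v, ir 'X_[v] = 'X_[jr v].
Hypothesis lp_jl : forall u w, lp (jl u + w)%MM = (u + lp w)%MM.
Hypothesis rp_jl : forall u w, rp (jl u + w)%MM = rp w.
Hypothesis lp_jr : forall v w, lp (jr v + w)%MM = lp w.
Hypothesis rp_jr : forall v w, rp (jr v + w)%MM = (v + rp w)%MM.
Hypothesis split_mnm : forall w, w = (jl (lp w) + jr (rp w))%MM.

Lemma tensor_regseq A B s : is_ideal A -> is_ideal B -> regseq A s ->
  regseq (sum_ideal (ext_ideal il A) (ext_ideal ir B)) (map il s).
Proof.
move=> + idB; elim: s A => [|f s IH] A idA //= [regf regs]; split.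
  exact: (tensor_regular (lp := lp) (rp := rp) (jl := jl) (jr := jr)).
rewrite -sum_adjl; try exact: ext_ideal_ideal.
by rewrite -ext_adj //; apply: IH => //; exact: adj_ideal.
Qed.

Lemma tensor_adjs A B s : is_ideal A -> is_ideal B ->
  adjs (sum_ideal (ext_ideal il A) (ext_ideal ir B)) (map il s) =
  sum_ideal (ext_ideal il (adjs A s)) (ext_ideal ir B).
Proof.
move=> + idB; elim: s A => [|f s IH] A idA //=.
rewrite -IH; last exact: adj_ideal.
by rewrite ext_adj // sum_adjl //; exact: ext_ideal_ideal.
Qed.

Lemma tensor_socle A B xs ys u v : is_ideal A -> is_ideal B ->
  socle A xs u -> socle B ys v ->
  socle (sum_ideal (ext_ideal il A) (ext_ideal ir B)) (map il xs ++ map ir ys) (il u * ir v).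
Proof.
move=> idA idB [nAu Au] [nBv Bv].
have idAe := ext_ideal_ideal il A; have idBe := ext_ideal_ideal ir B.
split.
  by move=> S; apply: (tensor_mul_notin (lp := lp) (rp := rp) (jl := jl) (jr := jr)) S.
move=> z; rewrite mem_cat => /orP[] /mapP[x xin ->].
  rewrite mulrA -rmorphM; apply: sum_ideal_subl => //.
  by apply: ideal_mulr => //; apply: mem_ext; exact: Au.
rewrite mulrCA -rmorphM; apply: sum_ideal_subr => //.
by apply: ideal_mull => //; apply: mem_ext; exact: Bv.
Qed.

End TensorSequences.

Section DisjointVariables.
Variables (K : fieldType) (n m : nat).
Local Notation S1 := {mpoly K[n]}.
Local Notation S2 := {mpoly K[m]}.
Local Notation S := {mpoly K[n + m]}.

Definition mnm_left (w : 'X_{1..n + m}) : 'X_{1..n} := [multinom w (lshift m i) | i < n].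
Definition mnm_right (w : 'X_{1..n + m}) : 'X_{1..m} := [multinom w (rshift n j) | j < m].
Definition mnm_join (u : 'X_{1..n}) (v : 'X_{1..m}) : 'X_{1..n + m} :=
  [multinom match split i with inl j => u j | inr k => v k end | i < n + m].

Definition incl_left : S1 -> S :=
  comp_mpoly [tuple ('X_(lshift m i) : S) | i < n].
Definition incl_right : S2 -> S :=
  comp_mpoly [tuple ('X_(rshift n j) : S) | j < m].

HB.instance Definition _ := GRing.LRMorphism.on incl_left.
HB.instance Definition _ := GRing.LRMorphism.on incl_right.

Lemma mnm_join_l u v i : mnm_join u v (lshift m i) = u i.
Proof. by rewrite mnmE (unsplitK (inl i)). Qed.

Lemma mnm_join_r u v j : mnm_join u v (rshift n j) = v j.
Proof. by rewrite mnmE (unsplitK (inr j)). Qed.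

Lemma mnm_leftK u v : mnm_left (mnm_join u v) = u.
Proof. by apply/mnmP => i; rewrite mnmE mnm_join_l. Qed.

Lemma mnm_rightK u v : mnm_right (mnm_join u v) = v.
Proof. by apply/mnmP => i; rewrite mnmE mnm_join_r. Qed.

Lemma mnm_leftD w1 w2 : mnm_left (w1 + w2)%MM = (mnm_left w1 + mnm_left w2)%MM.
Proof. by apply/mnmP => i; rewrite !(mnmE, mnmDE). Qed.

Lemma mnm_rightD w1 w2 : mnm_right (w1 + w2)%MM = (mnm_right w1 + mnm_right w2)%MM.
Proof. by apply/mnmP => i; rewrite !(mnmE, mnmDE). Qed.

Lemma eq_mnm_join (w1 w2 : 'X_{1..n + m}) :
  mnm_left w1 = mnm_left w2 -> mnm_right w1 = mnm_right w2 -> w1 = w2.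
Proof.
move=> /mnmP eql /mnmP eqr; apply/mnmP => i; case: (split_ordP i) => j ->.
  by have := eql j; rewrite !mnmE.
by have := eqr j; rewrite !mnmE.
Qed.

Lemma mnm_joinK w : mnm_join (mnm_left w) (mnm_right w) = w.
Proof. by apply: eq_mnm_join; rewrite (mnm_leftK, mnm_rightK). Qed.

Lemma mnm_joinD u1 u2 v1 v2 :
  (mnm_join u1 v1 + mnm_join u2 v2 = mnm_join (u1 + u2) (v1 + v2))%MM.
Proof.
by apply: eq_mnm_join; rewrite (mnm_leftD, mnm_rightD) !(mnm_leftK, mnm_rightK).
Qed.

Lemma mnm_join_le u1 u2 v1 v2 :
  (mnm_join u1 v1 <= mnm_join u2 v2)%MM = (u1 <= u2)%MM && (v1 <= v2)%MM.
Proof.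
apply/mnm_lepP/andP => [le|[/mnm_lepP leu /mnm_lepP lev] i].
  split; apply/mnm_lepP => i; first by have := le (lshift m i); rewrite !mnm_join_l.
  by have := le (rshift n i); rewrite !mnm_join_r.
by case: (split_ordP i) => j ->; rewrite ?mnm_join_l ?mnm_join_r.
Qed.

Lemma mdeg_join u v : mdeg (mnm_join u v) = (mdeg u + mdeg v)%N.
Proof.
rewrite !mdegE big_split_ord /=.
by congr addn; apply: eq_bigr => i _; rewrite ?mnm_join_l ?mnm_join_r.
Qed.

Lemma incl_leftX u : incl_left 'X_[u] = 'X_[mnm_join u 0].
Proof.
rewrite /incl_left comp_mpolyX [RHS]mpolyXE_id big_split_ord /= [X in _ = _ * X]big1.
  by rewrite mulr1; apply: eq_bigr => i _; rewrite tnth_mktuple mnm_join_l.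
by move=> i _; rewrite mnm_join_r mnm0E expr0.
Qed.

Lemma incl_rightX v : incl_right 'X_[v] = 'X_[mnm_join 0 v].
Proof.
rewrite /incl_right comp_mpolyX [RHS]mpolyXE_id big_split_ord /= [X in _ = X * _]big1.
  by rewrite mul1r; apply: eq_bigr => i _; rewrite tnth_mktuple mnm_join_r.
by move=> i _; rewrite mnm_join_l mnm0E expr0.
Qed.

Lemma left_add_l u w : mnm_left (mnm_join u 0 + w)%MM = (u + mnm_left w)%MM.
Proof. by rewrite mnm_leftD mnm_leftK. Qed.
Lemma right_add_l u w : mnm_right (mnm_join u 0 + w)%MM = mnm_right w.
Proof. by rewrite mnm_rightD mnm_rightK add0m. Qed.
Lemma left_add_r v w : mnm_left (mnm_join 0 v + w)%MM = mnm_left w.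
Proof. by rewrite mnm_leftD mnm_leftK add0m. Qed.
Lemma right_add_r v w : mnm_right (mnm_join 0 v + w)%MM = (v + mnm_right w)%MM.
Proof. by rewrite mnm_rightD mnm_rightK. Qed.
Lemma mnm_split w : w = (mnm_join (mnm_left w) 0 + mnm_join 0 (mnm_right w))%MM.
Proof. by rewrite mnm_joinD addm0 add0m mnm_joinK. Qed.
Lemma mnm_splitC w : w = (mnm_join 0 (mnm_right w) + mnm_join (mnm_left w) 0)%MM.
Proof. by rewrite addmC -mnm_split. Qed.

(** Modulo the entries of [s] the left ideal is merely replaced by a larger
    one, so the second half is the first half with the factors exchanged. *)
Lemma disjoint_regseq A B s t : is_ideal A -> is_ideal B -> regseq A s -> regseq B t ->
  regseq (sum_ideal (ext_ideal incl_left A) (ext_ideal incl_right B))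
    (map incl_left s ++ map incl_right t).
Proof.
move=> idA idB regs regt; apply/regseq_cat; split.
  exact: (tensor_regseq incl_leftX incl_rightX left_add_l right_add_l left_add_r
    right_add_r mnm_split).
rewrite tensor_adjs // sum_idealC; try exact: ext_ideal_ideal.
apply: (tensor_regseq incl_rightX incl_leftX right_add_r left_add_r right_add_l
    left_add_l mnm_splitC) => //.
exact: adjs_ideal.
Qed.

Lemma disjoint_socle A B s t xs ys : is_ideal A -> is_ideal B ->
  has_socle (adjs A s) xs -> has_socle (adjs B t) ys ->
  has_socle (adjs (sum_ideal (ext_ideal incl_left A) (ext_ideal incl_right B))
    (map incl_left s ++ map incl_right t)) (map incl_left xs ++ map incl_right ys).
Proof.
move=> idA idB [u socu] [v socv]; exists (incl_left u * incl_right v).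
have [idAs idBt] := (adjs_ideal s idA, adjs_ideal t idB).
rewrite adjs_cat tensor_adjs // sum_idealC; try exact: ext_ideal_ideal.
rewrite tensor_adjs // sum_idealC; try exact: ext_ideal_ideal.
exact: (tensor_socle incl_leftX incl_rightX left_add_l right_add_l left_add_r
    right_add_r mnm_split).
Qed.

End DisjointVariables.

(** * Monomial ideals *)

Section MonomialIdeals.
Variables (K : fieldType) (n : nat).
Local Notation T := {mpoly K[n]}.
Implicit Types (A : 'X_{1..n} -> Prop) (J : T -> Prop) (p : T) (u v w : 'X_{1..n}).

Lemma mnm_idealP A p : mnm_ideal A p <->
  forall w, w \in msupp p -> exists2 u, A u & (u <= w)%MM.
Proof.
split.
  pose I (q : T) := forall w, w \in msupp q -> exists2 u, A u & (u <= w)%MM.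
  apply: (ideal_gen_min (I := I)) => [|_ [u Au ->] w]; last first.
    by rewrite msuppX inE => /eqP->; exists u => //; exact: lepm_refl.
  split=> [w|q r Aq Ar w|a q Aq w]; first by rewrite msupp0.
    by move=> /msuppD_le; rewrite mem_cat => /orP[/Aq|/Ar].
  move=> /msuppM_le/allpairsP[[w1 w2] /= [_ /Aq[u Au leu] ->]].
  by exists u => //; apply: lepm_trans leu _; exact: lem_addl.
have idA : is_ideal (mnm_ideal (K := K) A) by exact: ideal_gen_ideal.
move=> Ap; rewrite [p]mpolyE big_seq; apply: (ideal_sum idA) => w /Ap[u Au leu].
rewrite -mul_mpolyC; apply: (ideal_mull idA).
rewrite -(submK leu) mpolyXD; apply: (ideal_mull idA).
by apply: mem_ideal_gen; exists u.
Qed.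

Lemma mnm_ideal_ideal A : is_ideal (mnm_ideal (K := K) A).
Proof. exact: ideal_gen_ideal. Qed.

Lemma mnm_idealX A w : mnm_ideal A ('X_[w] : T) <-> exists2 u, A u & (u <= w)%MM.
Proof.
rewrite mnm_idealP; split=> [|ex w']; first by apply; rewrite msuppX inE.
by rewrite msuppX inE => /eqP->.
Qed.

Lemma adj_mnm_ideal A v :
  adj (mnm_ideal A) ('X_[v] : T) = mnm_ideal (fun u => A u \/ u = v).
Proof.
apply: pred_ext => p; split.
  apply: adj_min; first exact: mnm_ideal_ideal.
    move=> q /mnm_idealP Aq; apply/mnm_idealP => w /Aq[u Au leu].
    by exists u => //; left.
  by apply: mem_ideal_gen; exists v => //; right.
apply: ideal_gen_min; first exact/adj_ideal/mnm_ideal_ideal.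
move=> _ [u [Au|->] ->]; last exact/gen_adj/mnm_ideal_ideal.
by apply: sub_adj; apply: mem_ideal_gen; exists u.
Qed.

Lemma zero_mnm_ideal : @zero_ideal T = mnm_ideal (fun _ => False).
Proof.
apply: pred_ext => p; rewrite mnm_idealP; split=> [->|H]; first by rewrite msupp0.
apply/msuppnil0/eqP; case: (msupp p) H => // w s H.
by have [|u] := H w; first by rewrite inE eqxx.
Qed.

Definition coprime_mnm u v : bool := [forall i, (u i == 0%N) || (v i == 0%N)].

Lemma coprime_mnm_le u v w : coprime_mnm u v -> (u <= w + v)%MM -> (u <= w)%MM.
Proof.
move=> /forallP cop /mnm_lepP le; apply/mnm_lepP => i.
by have := le i; rewrite mnmDE; case/orP: (cop i) => /eqP->; rewrite ?addn0.
Qed.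

Lemma mnm_ideal_regular A v : (forall u, A u -> coprime_mnm u v) ->
  regular (mnm_ideal A) ('X_[v] : T).
Proof.
move=> cop p; rewrite !mnm_idealP => Avp w wp.
have [|u Au leu] := Avp (w + v)%MM.
  by rewrite mulrC mcoeff_msupp addmC mcoeffMX -mcoeff_msupp.
by exists u => //; apply: coprime_mnm_le leu; exact: cop.
Qed.

Lemma coprime_mnmC u v : coprime_mnm u v = coprime_mnm v u.
Proof. by apply: eq_forallb => i; rewrite orbC. Qed.

(** Multiplication by a monomial cannot create divisibility by a monomial with
    disjoint support. *)
Lemma mnm_regseq A (s : seq 'X_{1..n}) :
  (forall u v, A u -> v \in s -> coprime_mnm u v) -> pairwise coprime_mnm s ->
  regseq (mnm_ideal A) [seq ('X_[u] : T) | u <- s].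
Proof.
elim: s A => [|v s IH] A //= copA /andP[/allP cops pws]; split.
  by apply: mnm_ideal_regular => u Au; apply: copA; rewrite // inE eqxx.
rewrite adj_mnm_ideal; apply: IH => // u w [Au|->] ws; last exact: cops.
by apply: copA; rewrite // inE ws orbT.
Qed.

Definition vars : seq T := [seq 'X_i | i <- enum 'I_n].

Lemma size_vars : size vars = n.
Proof. by rewrite size_map size_enum_ord. Qed.

Lemma irrelevant_span : @irrelevant_ideal K n = in_span vars.
Proof.
apply: pred_ext => p; split.
  apply: ideal_gen_min; first exact: span_ideal.
  by move=> _ [i ->]; apply: mem_span; apply: map_f; rewrite mem_enum.
move=> xsp; apply: xsp; first exact: ideal_gen_ideal.
by move=> _ /mapP[i _ ->]; apply: mem_ideal_gen; exists i.
Qed.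

Lemma irrelevantP p : irrelevant_ideal p <-> p@_0%MM = 0.
Proof.
have -> : @irrelevant_ideal K n = mnm_ideal (fun u => exists i, u = U_(i)%MM).
  apply: pred_ext => q; split; apply: ideal_gen_min; try exact: ideal_gen_ideal.
    by move=> _ [i ->]; apply: mem_ideal_gen; exists U_(i)%MM => //; exists i.
  by move=> _ [_ [i ->] ->]; apply: mem_ideal_gen; exists i.
rewrite mnm_idealP; split=> [H|p0 w wp].
  apply/eqP; rewrite mcoeff_eq0; apply/negP => /H[_ [i ->]].
  by rewrite lep1mP mnm0E.
have : w != 0%MM by apply: contraTneq wp => ->; rewrite -mcoeff_eq0 p0.
rewrite -mdeg_eq0 mdegE sum_nat_eq0 => /forallPn[i] /=; rewrite -lep1mP => lei.
by exists U_(i)%MM => //; exists i.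
Qed.

Lemma irrelevant1 : ~ irrelevant_ideal (1 : T).
Proof. by rewrite irrelevantP mcoeff1 eqxx => /eqP; rewrite oner_eq0. Qed.

Lemma proper_irrelevant A : ~ mnm_ideal A (1 : T) ->
  forall p, mnm_ideal A p -> @irrelevant_ideal K n p.
Proof.
rewrite -mpolyX0 mnm_idealX => nA p /mnm_idealP Ap; apply/irrelevantP/eqP.
by rewrite mcoeff_eq0; apply/negP => /Ap.
Qed.

(** Gives the polynomial ring itself grade the number of variables; it also
    completes regular sequences of one factor to sequences of the whole ring. *)
Lemma vars_regseq : regseq (@zero_ideal T) vars.
Proof.
rewrite zero_mnm_ideal /vars (map_comp (fun u => 'X_[u]) (fun i => U_(i)%MM)).
apply: mnm_regseq => //; rewrite pairwise_map.
have := enum_uniq 'I_n; rewrite uniq_pairwise; apply: sub_pairwise => i j /= neij.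
apply/forallP => k; rewrite !mnm1E; case: (eqVneq i k) neij => [->|//].
by rewrite eq_sym => /negPf->; rewrite orbT.
Qed.

End MonomialIdeals.

Arguments coprime_mnm {n} u v.

(** * Depth of quotients of polynomial rings *)

Section Depth.
Variables (K : fieldType) (n : nat).
Local Notation T := {mpoly K[n]}.
Variables (J : T -> Prop) (xs : seq T).
Hypotheses (idJ : is_ideal J) (xsE : in_span xs = @irrelevant_ideal K n).
Hypothesis Jirr : forall p, J p -> irrelevant_ideal p.

(** The maximum defining the depth exists, and it is attained by a sequence with
    a socle at the end; such sequences all have the same length. *)
Lemma depth_max : is_max_nat (fun r => exists s : seq T,
    [/\ size s = r, forall f, f \in s -> irrelevant_ideal f
      & regular_on_quotient J s]) (quotient_depth J) /\
  exists s, [/\ size s = quotient_depth J, {in s, forall f, in_span xs f}, regseq J s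
    & has_socle (adjs J s) xs].
Proof.
have n1 : ~ in_span xs 1 by rewrite xsE; exact: irrelevant1.
have [|s [xss regs soc]] := ex_maximal_regseq (@mpoly_noetherian K n) n1 idJ.
  by rewrite xsE.
have maxs : is_max_nat (fun r => exists s : seq T,
    [/\ size s = r, forall f, f \in s -> irrelevant_ideal f
      & regular_on_quotient J s]) (size s).
  split.
    exists s; split=> //; first by move=> f /xss; rewrite xsE.
    apply/regular_on_quotientE => //; split=> // s1; apply: n1.
    by apply: adjs_min s1 => //; [exact: span_ideal | rewrite xsE].
  move=> _ [t [<- xst /(regular_on_quotientE _ idJ)[regt _]]].
  apply: (grade_eq_ge (regseq_grade_eq idJ xss regs soc)).
  by apply: regseq_grade_ge => // f /xst; rewrite xsE.
have depthP := epsilon_spec (inhabits 0%N) _ (ex_intro _ _ maxs).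
split; first exact: depthP.
exists s; split=> //; apply/eqP; rewrite eqn_leq; apply/andP; split.
  by case: depthP => _; apply; case: maxs.
by case: maxs => _; apply; case: depthP.
Qed.

Lemma depth_regseq : exists s, [/\ size s = quotient_depth J,
  {in s, forall f, in_span xs f}, regseq J s & has_socle (adjs J s) xs].
Proof. by case: depth_max. Qed.

Lemma depth_grade r : grade_eq r J xs -> quotient_depth J = r.
Proof.
have [s [<- xss regs soc]] := depth_regseq.
exact/grade_eq_inj/regseq_grade_eq.
Qed.

End Depth.

Lemma msupp_mul_span (K : fieldType) n (J : {mpoly K[n]} -> Prop) d p :
  (forall q, J q -> forall w, w \in msupp q -> (d <= mdeg w)%N) ->
  mul_span J (vars K n) p -> forall w, w \in msupp p -> (d < mdeg w)%N.
Proof.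
move=> Jd Jp.
pose I (q : {mpoly K[n]}) := forall w, w \in msupp q -> (d < mdeg w)%N.
apply: (Jp I).
  split=> [w|q r Hq Hr w|a q Hq w]; first by rewrite msupp0.
    by move=> /msuppD_le; rewrite mem_cat => /orP[/Hq|/Hr].
  move=> /msuppM_le/allpairsP[[w1 w2] /= [_ /Hq lt ->]].
  by rewrite mdegD; apply: leq_trans lt _; exact: leq_addl.
move=> _ j /mapP[i _ ->] Jj w /msuppM_le/allpairsP[[w1 w2] /= []].
rewrite msuppX inE => /eqP-> /(Jd j Jj) le ->.
by rewrite mdegD mdeg1 add1n ltnS.
Qed.

(** Otherwise [regseq_full] gives that [J] is contained in the irrelevant ideal
    times [J], contradicting the existence of an element of least degree. *)
Lemma depth_lt (K : fieldType) n (A : 'X_{1..n} -> Prop) :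
  ~ mnm_ideal A (1 : {mpoly K[n]}) -> (exists u, A u) ->
  (quotient_depth (mnm_ideal (K := K) A) < n)%N.
Proof.
move=> nA1 [u0 Au0]; have idA := mnm_ideal_ideal K A.
have xsE := esym (irrelevant_span K n).
have [s [szs xss regs _]] := depth_regseq idA xsE (proper_irrelevant nA1).
rewrite ltnNge; apply/negP; rewrite -szs => lens.
have szt : size (take n s) = size (vars K n).
  by rewrite size_takel // size_map size_enum_ord.
have regt : regseq (mnm_ideal A) (take n s).
  by move: regs; rewrite -{1}(cat_take_drop n s) => /regseq_cat[].
have [|d [u Au dE] mind] := nat_least (P := fun d => exists2 u, A u & d = mdeg u).
  by exists (mdeg u0), u0.
rewrite {d}dE in mind.
have Ju : mnm_ideal A ('X_[u] : {mpoly K[n]}).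
  by apply/mnm_idealX; exists u => //; exact: lepm_refl.
have xsu : in_span (vars K n) 'X_[u] by rewrite xsE; exact: proper_irrelevant Ju.
have xst : {in take n s, forall f, sum_ideal (mnm_ideal A) (in_span (vars K n)) f}.
  by move=> f /mem_take fs; apply: sum_ideal_subr => //; exact: xss.
have Jd (q : {mpoly K[n]}) : mnm_ideal A q -> forall w, w \in msupp q -> (mdeg u <= mdeg w)%N.
  move=> /mnm_idealP Aq w /Aq[v Av lev].
  apply: leq_trans (mind _ (ex_intro2 _ _ v Av erefl)) _.
  by rewrite -(submK lev) mdegD leq_addl.
have := msupp_mul_span Jd (regseq_full idA szt xst regt Ju xsu) (w := u).
by rewrite msuppX inE eqxx ltnn => /(_ isT).
Qed.

Section DisjointDepth.
Variables (K : fieldType) (n m : nat).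
Local Notation S := {mpoly K[n + m]}.
Variables (A1 : 'X_{1..n} -> Prop) (A2 : 'X_{1..m} -> Prop).

(** The products of a monomial from [A1] with one from [A2]. *)
Definition join_set (w : 'X_{1..n + m}) : Prop := A1 (mnm_left w) /\ A2 (mnm_right w).

Lemma ext_left_mnm : ext_ideal (@incl_left K n m) (mnm_ideal A1) =
  mnm_ideal (fun w => exists2 u, A1 u & w = mnm_join u 0).
Proof.
apply: pred_ext => p; split; last first.
  apply: ideal_gen_min; first exact: ext_ideal_ideal.
  move=> _ [_ [u Au ->] ->]; rewrite -incl_leftX; apply: mem_ext.
  by apply: mem_ideal_gen; exists u.
apply: ideal_gen_min; first exact: mnm_ideal_ideal.
move=> _ [q [c cA ->] ->]; rewrite rmorph_sum big_seq.
apply: (ideal_sum (mnm_ideal_ideal _ _)) => ag /cA[u Au ->]; rewrite rmorphM /= incl_leftX.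
apply: (ideal_mull (mnm_ideal_ideal _ _)); apply: mem_ideal_gen.
by exists (mnm_join u 0) => //; exists u.
Qed.

Lemma ext_right_mnm : ext_ideal (@incl_right K n m) (mnm_ideal A2) =
  mnm_ideal (fun w => exists2 v, A2 v & w = mnm_join 0 v).
Proof.
apply: pred_ext => p; split; last first.
  apply: ideal_gen_min; first exact: ext_ideal_ideal.
  move=> _ [_ [u Au ->] ->]; rewrite -incl_rightX; apply: mem_ext.
  by apply: mem_ideal_gen; exists u.
apply: ideal_gen_min; first exact: mnm_ideal_ideal.
move=> _ [q [c cA ->] ->]; rewrite rmorph_sum big_seq.
apply: (ideal_sum (mnm_ideal_ideal _ _)) => ag /cA[u Au ->]; rewrite rmorphM /= incl_rightX.
apply: (ideal_mull (mnm_ideal_ideal _ _)); apply: mem_ideal_gen.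
by exists (mnm_join 0 u) => //; exists u.
Qed.

Lemma cap_ext_mnm :
  cap_ideal (ext_ideal (@incl_left K n m) (mnm_ideal A1))
            (ext_ideal (@incl_right K n m) (mnm_ideal A2)) = mnm_ideal join_set.
Proof.
rewrite ext_left_mnm ext_right_mnm; apply: pred_ext => p.
rewrite /cap_ideal !mnm_idealP; split=> [[H1 H2] w wp|H].
  have [_ [u Au ->] leu] := H1 w wp; have [_ [v Av ->] lev] := H2 w wp.
  exists (mnm_join u v); first by rewrite /join_set mnm_leftK mnm_rightK.
  move: leu lev; rewrite -(mnm_joinK w) !mnm_join_le => /andP[-> _] /andP[_ ->] //.
split=> w /H[v [A1v A2v] lev].
  exists (mnm_join (mnm_left v) 0); first by exists (mnm_left v).
  apply: lepm_trans lev; rewrite -{2}(mnm_joinK v) mnm_join_le lepm_refl /=.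
  by apply/mnm_lepP => i; rewrite mnm0E.
exists (mnm_join 0 (mnm_right v)); first by exists (mnm_right v).
apply: lepm_trans lev; rewrite -{2}(mnm_joinK v) mnm_join_le lepm_refl andbT.
by apply/mnm_lepP => i; rewrite mnm0E.
Qed.

(** The generic element depends on the list of generators, so the variables are
    listed as the two factors provide them. *)
Lemma irrelevant_join :
  in_span (map (@incl_left K n m) (vars K n) ++ map (@incl_right K n m) (vars K m)) =
  @irrelevant_ideal K (n + m).
Proof.
have lX i : @incl_left K n m 'X_i = 'X_(lshift m i).
  rewrite incl_leftX; congr 'X_[_]; apply: eq_mnm_join.
    by rewrite mnm_leftK; apply/mnmP => j; rewrite !mnmE (inj_eq (@lshift_inj _ _)).
  by rewrite mnm_rightK; apply/mnmP => j; rewrite !mnmE eq_lrshift.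
have rX i : @incl_right K n m 'X_i = 'X_(rshift n i).
  rewrite incl_rightX; congr 'X_[_]; apply: eq_mnm_join.
    by rewrite mnm_leftK; apply/mnmP => j; rewrite !mnmE eq_rlshift.
  by rewrite mnm_rightK; apply/mnmP => j; rewrite !mnmE (inj_eq (@rshift_inj _ _)).
apply: pred_ext => p; split.
  apply; first exact: ideal_gen_ideal.
  move=> q; rewrite mem_cat => /orP[] /mapP[_ /mapP[i _ ->] ->]; apply: mem_ideal_gen.
    by exists (lshift m i); rewrite -lX.
  by exists (rshift n i); rewrite -rX.
apply: ideal_gen_min; first exact: span_ideal.
move=> _ [i ->]; apply: mem_span; rewrite mem_cat; apply/orP.
case: (split_ordP i) => j ->; [left; rewrite -lX | right; rewrite -rX].
  by apply/map_f/map_f; rewrite mem_enum.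
by apply/map_f/map_f; rewrite mem_enum.
Qed.

Lemma sum_ideal_zero (R : comNzRingType) (I : R -> Prop) :
  sum_ideal I (@zero_ideal R) = I.
Proof.
apply: pred_ext => p; split=> [[a Ia /eqP]|Ip]; last by exists p; rewrite /zero_ideal ?subrr.
by rewrite subr_eq0 => /eqP->.
Qed.

Lemma ext_zero k (f : {lrmorphism {mpoly K[k]} -> S}) :
  ext_ideal f (@zero_ideal _) = @zero_ideal S.
Proof.
apply: pred_ext => p; split; last by move=> ->; exact: (ideal_zero (ext_ideal_ideal _ _)).
apply: ideal_gen_min; first exact: zero_ideal_ideal.
by move=> _ [_ -> ->]; rewrite rmorph0.
Qed.

Hypotheses (A1nz : exists u, A1 u) (A2nz : exists v, A2 v).
Hypotheses (A1p : ~ mnm_ideal A1 (1 : {mpoly K[n]})) (A2p : ~ mnm_ideal A2 (1 : {mpoly K[m]})).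

(** The quotient by the sum of the extensions has grade [d1 + d2] by
    concatenation of maximal sequences.  On each single extension the missing
    half is replaced by all variables of the other group, giving a
    regular sequence longer by at least one, as [depth_lt] shows; then
    [grade_eq_cap] applies. *)
Lemma depth_join : quotient_depth (mnm_ideal (K := K) join_set) =
  (quotient_depth (mnm_ideal (K := K) A1) + quotient_depth (mnm_ideal (K := K) A2)).+1.
Proof.
have [id1 id2] := (mnm_ideal_ideal K A1, mnm_ideal_ideal K A2).
have xsE1 := esym (irrelevant_span K n); have xsE2 := esym (irrelevant_span K m).
have xsE := irrelevant_join.
have [s [szs xss regs socs]] := depth_regseq id1 xsE1 (proper_irrelevant A1p).
have [t [szt xst regt soct]] := depth_regseq id2 xsE2 (proper_irrelevant A2p).
have lt1 := depth_lt A1p A1nz; have lt2 := depth_lt A2p A2nz.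
have ide1 := ext_ideal_ideal (@incl_left K n m) (mnm_ideal A1).
have ide2 := ext_ideal_ideal (@incl_right K n m) (mnm_ideal A2).
have idz k := @zero_ideal_ideal {mpoly K[k]}.
set xs := _ ++ _ in xsE.
have spanl f : in_span (vars K n) f -> in_span xs (@incl_left K n m f).
  move=> xsf; apply: (xsf (fun f => in_span xs (@incl_left K n m f))).
    split=> [|p q|a p]; rewrite (rmorph0, rmorphD, rmorphM); have [h0 hD hM] := span_ideal xs.
    - exact: h0.
    - exact: hD.
    - exact: hM.
  by move=> x xsx; apply: mem_span; rewrite mem_cat map_f.
have spanr f : in_span (vars K m) f -> in_span xs (@incl_right K n m f).
  move=> xsf; apply: (xsf (fun f => in_span xs (@incl_right K n m f))).
    split=> [|p q|a p]; rewrite (rmorph0, rmorphD, rmorphM); have [h0 hD hM] := span_ideal xs.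
    - exact: h0.
    - exact: hD.
    - exact: hM.
  by move=> x xsx; apply: mem_span; rewrite mem_cat orbC map_f.
have span_cat s' t' : {in s', forall f, in_span (vars K n) f} ->
    {in t', forall f, in_span (vars K m) f} ->
    {in map (@incl_left K n m) s' ++ map (@incl_right K n m) t', forall f, in_span xs f}.
  by move=> h1 h2 f; rewrite mem_cat => /orP[] /mapP[g gin ->]; auto.
have spanx k : {in vars K k, forall f, in_span (vars K k) f}.
  by move=> f; exact: mem_span.
have eqS : grade_eq (size s + size t)
    (sum_ideal (ext_ideal (@incl_left K n m) (mnm_ideal A1))
               (ext_ideal (@incl_right K n m) (mnm_ideal A2))) xs.
  have := regseq_grade_eq (sum_ideal_ideal ide1 ide2) (span_cat _ _ xss xst)
    (disjoint_regseq id1 id2 regs regt) (disjoint_socle id1 id2 socs soct).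
  by rewrite size_cat !size_map.
have ge1 : grade_ge (size s + size t).+1
    (ext_ideal (@incl_left K n m) (mnm_ideal A1)) xs.
  have := regseq_grade_ge (sum_ideal_ideal ide1 (ext_ideal_ideal _ _))
     (span_cat _ _ xss (spanx m)) (disjoint_regseq id1 (idz m) regs (vars_regseq K m)).
  rewrite ext_zero sum_ideal_zero => /grade_ge_leq; apply.
  by rewrite size_cat 2!size_map size_vars -addnS leq_add2l szt.
have ge2 : grade_ge (size s + size t).+1
    (ext_ideal (@incl_right K n m) (mnm_ideal A2)) xs.
  have := regseq_grade_ge (sum_ideal_ideal (ext_ideal_ideal _ _) ide2)
     (span_cat _ _ (spanx n) xst) (disjoint_regseq (idz n) id2 (vars_regseq K n) regt).
  rewrite ext_zero sum_idealC ?sum_ideal_zero //; last exact: zero_ideal_ideal.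
  move=> /grade_ge_leq; apply.
  by rewrite size_cat (size_map _ (vars K n)) (size_map _ t) size_vars -addSn leq_add2r szs.
have := grade_eq_cap ide1 ide2 ge1 ge2 eqS; rewrite cap_ext_mnm szs szt.
apply: depth_grade => //; first exact: mnm_ideal_ideal.
apply: proper_irrelevant => /mnm_idealP H.
apply: A1p; apply/mnm_idealP => w; rewrite msupp1 inE => /eqP->.
have [|v [A1v _] le0] := H 0%MM; first by rewrite msupp1 inE.
exists (mnm_left v) => //; apply/mnm_lepP => i; move/mnm_lepP: le0 => /(_ (lshift m i)).
by rewrite !mnm0E mnmE.
Qed.

End DisjointDepth.

(** * Squarefree powers, initial degree and monomial grade *)

Lemma nat_greatest (P : nat -> Prop) b : P 0%N -> (forall k, P k -> (k <= b)%N) ->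
  exists k, is_max_nat P k.
Proof.
move=> P0 bound; have [|d Pd mind] := nat_least (P := fun d => (d <= b)%N /\ P (b - d)%N).
  by exists b; rewrite subnn.
case: Pd => led Pbd; exists (b - d)%N; split=> // e Pe.
have leb := bound e Pe; have [|] := leqP e (b - d); first by [].
have := mind (b - e)%N; rewrite leq_subr subKn // => /(_ (conj isT Pe)); lia.
Qed.

Lemma is_min_nat_inj P d e : is_min_nat P d -> is_min_nat P e -> d = e.
Proof.
by move=> [Pd mind] [Pe mine]; apply/eqP; rewrite eqn_leq mind ?mine.
Qed.

Section Powers.
Variables (K : fieldType) (n : nat).
Local Notation T := {mpoly K[n]}.
Implicit Types (A B : 'X_{1..n} -> Prop) (u v w : 'X_{1..n}).

Fixpoint mnm_sums A (k : nat) : 'X_{1..n} -> Prop :=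
  if k is k'.+1 then fun w => exists u v, [/\ A u, mnm_sums A k' v & w = (u + v)%MM]
  else fun w => w = 0%MM.

(** The exponents of the generators of the [k]th squarefree power: squarefree
    multiples of a product of [k] elements of [A]. *)
Definition sqfree_sums A k u : Prop :=
  sqfree_mnm u /\ exists2 v, mnm_sums A k v & (v <= u)%MM.

Lemma ideal_mul_mnm A B : ideal_mul (mnm_ideal (K := K) A) (mnm_ideal B) =
  mnm_ideal (fun w => exists u v, [/\ A u, B v & w = (u + v)%MM]).
Proof.
apply: pred_ext => p; split; apply: ideal_gen_min; try exact: ideal_gen_ideal.
  move=> _ [a [b [/mnm_idealP Aa /mnm_idealP Bb ->]]]; apply/mnm_idealP => w.
  move=> /msuppM_le/allpairsP[[w1 w2] /= [/Aa[u Au leu] /Bb[v Bv lev] ->]].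
  exists (u + v)%MM; first by exists u, v.
  by apply/mnm_lepP => i; rewrite !mnmDE; apply: leq_add; apply/mnm_lepP.
move=> _ [_ [u [v [Au Bv ->]] ->]]; apply: mem_ideal_gen.
exists 'X_[u], 'X_[v]; rewrite mpolyXD; split=> //; apply: mem_ideal_gen.
  by exists u.
by exists v.
Qed.

Lemma ideal_pow_mnm A k : ideal_pow (mnm_ideal (K := K) A) k = mnm_ideal (mnm_sums A k).
Proof.
elim: k => [|k IH] /=; last by rewrite IH ideal_mul_mnm.
apply: pred_ext => p; split=> // _; apply/mnm_idealP => w _.
by exists 0%MM => //; apply/mnm_lepP => i; rewrite mnm0E.
Qed.

Lemma sqfree_pow_mnm A k :
  sqfree_pow (mnm_ideal (K := K) A) k = mnm_ideal (sqfree_sums A k).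
Proof.
rewrite /sqfree_pow; congr mnm_ideal; apply: pred_ext => u.
by rewrite ideal_pow_mnm mnm_idealX.
Qed.

Lemma sqfree_pow_proper A k : ~ mnm_ideal A (1 : T) -> (0 < k)%N ->
  ~ mnm_ideal (sqfree_sums A k) (1 : T).
Proof.
rewrite -mpolyX0 !mnm_idealX => nA; case: k => // k _ [w [_ [_ [u [v [Au _ ->]]] le1]] le2].
apply: nA; exists u => //; apply: lepm_trans le2; apply: lepm_trans le1.
exact: lem_addr.
Qed.

Lemma lepm_deg u v : (u <= v)%MM -> (mdeg u <= mdeg v)%N.
Proof. by move=> /submK<-; rewrite mdegD leq_addl. Qed.

Lemma lepm_deg_eq u v : (u <= v)%MM -> (mdeg v <= mdeg u)%N -> u = v.
Proof.
move=> le; rewrite -{1 2}(submK le) mdegD -[X in (_ <= X)%N]add0n leq_add2r leqn0 mdeg_eq0.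
by move=> /eqP->; rewrite add0m.
Qed.

(** A monomial of least degree is a minimal generator. *)
Lemma indegP A : (exists u, A u) ->
  is_min_nat (fun d => exists2 u, A u & mdeg u = d) (indeg (mnm_ideal (K := K) A)).
Proof.
move=> [u0 Au0].
have [|d [u Au ud] mind] := nat_least (P := fun d => exists2 u, A u & mdeg u = d).
  by exists (mdeg u0), u0.
have min1 : is_min_nat (fun d => exists2 u, A u & mdeg u = d) d.
  by split=> //; exists u.
have min2 : is_min_nat (fun d => exists2 u, min_generator (mnm_ideal (K := K) A) u &
    mdeg u = d) d.
  split=> [|_ [w [/mnm_idealX[v Av lev] _] <-]]; last first.
    by apply: leq_trans (lepm_deg lev); apply: mind; exists v.
  exists u => //; split; first by apply/mnm_idealX; exists u => //; exact: lepm_refl.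
  move=> w /mnm_idealX[v Av lev] lew; apply: lepm_deg_eq => //; rewrite ud.
  by apply: leq_trans (lepm_deg lev); apply: mind; exists v.
have min3 := epsilon_spec (inhabits 0%N) _ (ex_intro _ _ min2).
by rewrite /indeg /min_nat (is_min_nat_inj min3 min2).
Qed.

Definition nonunit (s : seq 'X_{1..n}) : Prop := {in s, forall u, u <> 0%MM}.

Lemma adjs_mnm A (s : seq 'X_{1..n}) :
  adjs (mnm_ideal A) [seq ('X_[u] : T) | u <- s] = mnm_ideal (fun u => A u \/ u \in s).
Proof.
elim: s A => [|v s IH] A /=; first by congr mnm_ideal; apply: pred_ext => u; split=> [|[]]; auto.
rewrite adj_mnm_ideal IH; congr mnm_ideal; apply: pred_ext => u; rewrite inE.
by split=> [[[Au|->]|us]|[Au|/predU1P[->|us]]]; rewrite ?eqxx ?us ?orbT; auto.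
Qed.

Lemma pairwise_mem (r : rel 'X_{1..n}) s u v : (forall a b, r a b = r b a) -> pairwise r s ->
  u \in s -> v \in s -> u != v -> r u v.
Proof.
move=> symr; elim: s => //= w s IH /andP[/allP rw pws].
rewrite !inE => /predU1P[->|us] /predU1P[->|vs]; rewrite ?eqxx // => neuv.
- exact: rw.
- by rewrite symr; exact: rw.
- exact: IH.
Qed.

(** If [x_i] divides both [u] in [s] and [v], then [v (u / x_i)] is a multiple of
    [u]; by regularity some member of [s] divides [u / x_i], and it is distinct
    from [u] and not coprime to it. *)
Lemma regular_mnm_coprime (s : seq 'X_{1..n}) v : pairwise coprime_mnm s -> nonunit s ->
  regular (mnm_ideal (fun u => u \in s)) ('X_[v] : T) ->
  {in s, forall u, coprime_mnm u v}.
Proof.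
move=> pws nus regv u us; apply/forallP => i; apply/norP => -[nzu nzv].
have le1 : (U_(i) <= v)%MM by rewrite lep1mP.
have leu : (U_(i) <= u)%MM by rewrite lep1mP.
have : mnm_ideal (fun u => u \in s) ('X_[u - U_(i)] : T).
  apply: regv; rewrite -mpolyXD; apply/mnm_idealX; exists u => //.
  apply/mnm_lepP => j; rewrite mnmDE mnmBE.
  by move/mnm_lepP: leu => /(_ j); move/mnm_lepP: le1 => /(_ j); lia.
move=> /mnm_idealX[u' u's leu']; have neu : u' != u.
  apply: contraTneq leu' => ->; apply/negP => /mnm_lepP/(_ i).
  by rewrite mnmBE mnm1E eqxx; move: nzu; case: (u i) => // k _; lia.
have cop := pairwise_mem (fun a b => coprime_mnmC a b) pws u's us neu.
apply: (nus u' u's); apply/mnmP => j; rewrite mnm0E.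
move/forallP: cop => /(_ j) /orP[] /eqP // uj0.
by move/mnm_lepP: leu' => /(_ j); rewrite mnmBE uj0; lia.
Qed.

Lemma mnm_regular_sequence (s : seq 'X_{1..n}) :
  regular_on_quotient (fun p : T => p = 0) [seq ('X_[u] : T) | u <- s] <->
  pairwise coprime_mnm s /\ nonunit s.
Proof.
rewrite (regular_on_quotientE _ (@zero_ideal_ideal T)) -/(@zero_ideal T) zero_mnm_ideal adjs_mnm.
rewrite -mpolyX0 mnm_idealX.
have nuE : ~ (exists2 u, False \/ u \in s & (u <= 0)%MM) <-> nonunit s.
  split=> [nex u us u0|nus [u [//|us] le0]].
    by apply: nex; exists u; [right | rewrite u0 lepm_refl].
  apply: (nus u us); apply/mnmP => i; apply/eqP; rewrite mnm0E -leqn0.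
  by move/mnm_lepP: le0 => /(_ i); rewrite mnm0E.
split=> [[regs /nuE nus]|[pws /nuE nus]]; last by split=> //; apply: mnm_regseq.
split=> //; elim/last_ind: s regs nus {nuE} => [|s v IH] // regs nus.
have nus' : nonunit s by move=> u us; apply: nus; rewrite mem_rcons inE us orbT.
move: regs; rewrite map_rcons -cats1 => /regseq_cat[regs [regv _]].
have pws := IH regs nus'; rewrite pairwise_rcons pws andbT; apply/allP.
apply: regular_mnm_coprime => //; move: regv; rewrite adjs_mnm.
by congr (regular (mnm_ideal _) _); apply: pred_ext => u; split=> [[]|]; auto.
Qed.

Definition mnm_grade_ge (I : T -> Prop) r : Prop := exists s : seq 'X_{1..n},
  [/\ size s = r, forall u, u \in s -> I 'X_[u], pairwise coprime_mnm s & nonunit s].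

(** The maximum exists because a regular sequence of nonunit monomials is at most
    as long as the grade of the irrelevant ideal, which the variables compute
    to be [n]. *)
Lemma monomial_gradeP I : is_max_nat (mnm_grade_ge I) (monomial_grade I).
Proof.
have E : mnm_grade_ge I = (fun r => exists s : seq 'X_{1..n},
    [/\ size s = r, forall u, u \in s -> I 'X_[u]
      & regular_on_quotient (fun p : T => p = 0) [seq ('X_[u] : T) | u <- s]]).
  apply: pred_ext => r; split=> -[s].
    by case=> szs Is pws nus; exists s; split=> //; apply/mnm_regular_sequence.
  by case=> szs Is /mnm_regular_sequence[pws nus]; exists s.
suff [d maxd] : exists d, is_max_nat (mnm_grade_ge I) d.
  by rewrite /monomial_grade /max_nat -E; exact: (epsilon_spec (inhabits 0%N) _ (ex_intro _ _ maxd)).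
apply: (nat_greatest (b := n)); first by exists [::].
move=> _ [s [<- _ pws nus]].
have idz := @zero_ideal_ideal T.
have soc : has_socle (adjs (@zero_ideal T) (vars K n)) (vars K n).
  rewrite -span_adjs; exists 1; split; first by rewrite -irrelevant_span; exact: irrelevant1.
  by move=> x xsx; rewrite mulr1; exact: mem_span.
have eqn : grade_eq (size (vars K n)) (@zero_ideal T) (vars K n).
  by apply: regseq_grade_eq => //; [move=> f; exact: mem_span | exact: vars_regseq].
rewrite size_vars in eqn; apply: (grade_eq_ge eqn).
rewrite -(size_map (fun u => 'X_[u] : T) s); apply: regseq_grade_ge => //.
  move=> _ /mapP[u us ->]; rewrite -irrelevant_span; apply/irrelevantP.
  rewrite mcoeffX; case: eqP => // u0; by case: (nus u us).
have /mnm_regular_sequence := conj pws nus.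
by rewrite (regular_on_quotientE _ idz) => -[].
Qed.

(** Squarefree divisors of pairwise coprime monomials have a squarefree product;
    the support condition keeps the induction going. *)
Lemma ex_sqfree_sums A (s : seq 'X_{1..n}) : (forall u, A u -> sqfree_mnm u) ->
  (forall u, u \in s -> mnm_ideal (K := K) A 'X_[u]) -> pairwise coprime_mnm s ->
  exists u, [/\ sqfree_mnm u, mnm_sums A (size s) u
    & forall i, u i <> 0%N -> exists2 v, v \in s & v i <> 0%N].
Proof.
move=> sqA; elim: s => [|v s IH] /= As.
  by move=> _; exists 0%MM; split=> // i; rewrite mnm0E.
move=> /andP[/allP copv pws].
have [|u [squ sumu suppu]] := IH _ pws; first by move=> u us; apply: As; rewrite inE us orbT.
have [|a Aa lea] := (iffLR (mnm_idealX K A v)) _; first by apply: As; rewrite inE eqxx.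
exists (a + u)%MM; split; last 1 first.
- move=> i; rewrite mnmDE => nz; have [ui0|/eqP nzu] := eqVneq (u i) 0%N.
    exists v; first by rewrite inE eqxx.
    by move/mnm_lepP: lea => /(_ i); lia.
  by have [w ws wi] := suppu i nzu; exists w => //; rewrite inE ws orbT.
- move=> i; rewrite mnmDE; have [ui0|/eqP nzu] := eqVneq (u i) 0%N.
    by rewrite ui0 addn0; exact: sqA.
  have [w ws /eqP wi] := suppu i nzu.
  have := copv w ws; move/forallP => /(_ i); rewrite (negPf wi) orbF => /eqP vi0.
  by move/mnm_lepP: lea => /(_ i); rewrite vi0 leqn0 => /eqP->; rewrite add0n; exact: squ.
by exists a, u.
Qed.

Lemma sqfree_pow_nonzero A k : (forall u, A u -> sqfree_mnm u) ->
  (k <= monomial_grade (mnm_ideal (K := K) A))%N -> exists u, sqfree_sums A k u.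
Proof.
move=> sqA; have [[s [<- As pws _]] _] := monomial_gradeP (mnm_ideal (K := K) A).
move=> lek; have [|| u [squ sumu _]] := ex_sqfree_sums (s := take k s) sqA.
- by move=> u /mem_take; exact: As.
- by move: pws; rewrite -{1}(cat_take_drop k s) pairwise_cat => /and3P[].
by rewrite size_takel // in sumu; exists u; split=> //; exists u => //; exact: lepm_refl.
Qed.

End Powers.

(** * The product of ideals in disjoint variables *)

Section Product.
Variables (K : fieldType) (n m : nat).
Variables (A1 : 'X_{1..n} -> Prop) (A2 : 'X_{1..m} -> Prop).

Lemma disjoint_product_mnm :
  disjoint_product (mnm_ideal (K := K) A1) (mnm_ideal A2) = mnm_ideal (join_set A1 A2).
Proof.
have -> : disjoint_product (mnm_ideal (K := K) A1) (mnm_ideal A2) =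
    ideal_mul (ext_ideal (@incl_left K n m) (mnm_ideal A1))
              (ext_ideal (@incl_right K n m) (mnm_ideal A2)) by [].
rewrite ext_left_mnm ext_right_mnm ideal_mul_mnm; congr mnm_ideal.
apply: pred_ext => w; split=> [[_ [_ [[u Au ->] [v Av ->] ->]]]|[A1w A2w]].
  by rewrite /join_set mnm_joinD addm0 add0m mnm_leftK mnm_rightK.
exists (mnm_join (mnm_left w) 0), (mnm_join 0 (mnm_right w)); rewrite -mnm_split.
by split=> //; [exists (mnm_left w) | exists (mnm_right w)].
Qed.

Lemma mnm_sums_join k w : mnm_sums (join_set A1 A2) k w <->
  mnm_sums A1 k (mnm_left w) /\ mnm_sums A2 k (mnm_right w).
Proof.
elim: k w => [|k IH] w /=.
  split=> [->|[l0 r0]]; last first.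
    by apply: eq_mnm_join; rewrite (l0, r0); apply/mnmP => i; rewrite mnm0E mnmE mnm0E.
  by split; apply/mnmP => i; rewrite mnmE !mnm0E.
split=> [[u [v [[A1u A2u] /IH[S1 S2] ->]]]|[[u1 [v1 [Au1 Sv1 e1]]] [u2 [v2 [Au2 Sv2 e2]]]]].
  rewrite mnm_leftD mnm_rightD; split; first by exists (mnm_left u), (mnm_left v).
  by exists (mnm_right u), (mnm_right v).
exists (mnm_join u1 u2), (mnm_join v1 v2); split.
- by rewrite /join_set mnm_leftK mnm_rightK.
- by apply/IH; rewrite mnm_leftK mnm_rightK.
- by rewrite mnm_joinD -e1 -e2 mnm_joinK.
Qed.

Lemma sqfree_sums_join k w : sqfree_sums (join_set A1 A2) k w <->
  join_set (sqfree_sums A1 k) (sqfree_sums A2 k) w.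
Proof.
split=> [[sqw [v /mnm_sums_join[S1 S2] lev]]|[[sq1 [v1 S1 le1]] [sq2 [v2 S2 le2]]]].
  move: lev; rewrite -(mnm_joinK v) -(mnm_joinK w) mnm_join_le mnm_joinK => /andP[le1 le2].
  split; split.
  - by move=> i; rewrite mnmE.
  - by exists (mnm_left v).
  - by move=> i; rewrite mnmE.
  - by exists (mnm_right v).
split.
  move=> i; case: (split_ordP i) => j ->; first by have := sq1 j; rewrite mnmE.
  by have := sq2 j; rewrite mnmE.
exists (mnm_join v1 v2); last by rewrite -(mnm_joinK w) mnm_join_le le1.
by apply/mnm_sums_join; rewrite mnm_leftK mnm_rightK.
Qed.

Lemma sqfree_pow_product k :
  sqfree_pow (disjoint_product (mnm_ideal (K := K) A1) (mnm_ideal A2)) k =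
  mnm_ideal (join_set (sqfree_sums A1 k) (sqfree_sums A2 k)).
Proof.
rewrite disjoint_product_mnm sqfree_pow_mnm; congr mnm_ideal.
by apply: pred_ext => w; exact: sqfree_sums_join.
Qed.

Lemma indeg_join : (exists u, A1 u) -> (exists v, A2 v) ->
  indeg (mnm_ideal (K := K) (join_set A1 A2)) =
  (indeg (mnm_ideal (K := K) A1) + indeg (mnm_ideal (K := K) A2))%N.
Proof.
move=> ex1 ex2; have [[u Au ud] min1] := indegP K ex1; have [[v Av vd] min2] := indegP K ex2.
apply: is_min_nat_inj (indegP K _) _.
  by exists (mnm_join u v); rewrite /join_set mnm_leftK mnm_rightK.
split; first by exists (mnm_join u v); rewrite ?mdeg_join ?ud ?vd // /join_set mnm_leftK mnm_rightK.
move=> _ [w [A1w A2w] <-]; rewrite -(mnm_joinK w) mdeg_join.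
by apply: leq_add; [apply: min1; exists (mnm_left w) | apply: min2; exists (mnm_right w)].
Qed.

End Product.

Section ProductDepth.
Variables (K : fieldType) (n m : nat).
Variables (A1 : 'X_{1..n} -> Prop) (A2 : 'X_{1..m} -> Prop).
Hypotheses (A1p : ~ mnm_ideal A1 (1 : {mpoly K[n]})) (A2p : ~ mnm_ideal A2 (1 : {mpoly K[m]})).

(** The left parts of pairwise coprime monomials of [I1 I2] are pairwise coprime
    monomials of [I1], and none of them is a unit. *)
Lemma monomial_grade_left :
  (monomial_grade (disjoint_product (mnm_ideal (K := K) A1) (mnm_ideal A2)) <=
   monomial_grade (mnm_ideal (K := K) A1))%N.
Proof.
have [_ max1] := monomial_gradeP (mnm_ideal (K := K) A1).
have [[s [<- Is pws _]] _] := monomial_gradeP (disjoint_product (mnm_ideal (K := K) A1) (mnm_ideal A2)).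
have I1s u : u \in s -> mnm_ideal (K := K) A1 'X_[mnm_left u].
  move=> /Is; rewrite disjoint_product_mnm !mnm_idealX => -[v [A1v _]].
  rewrite -(mnm_joinK v) -(mnm_joinK u) mnm_join_le mnm_leftK => /andP[le1 _].
  by exists (mnm_left v).
apply: max1; exists (map (@mnm_left n m) s); rewrite size_map; split=> //.
- by move=> _ /mapP[u us ->]; exact: I1s.
- rewrite pairwise_map; apply: sub_pairwise pws => u v /forallP cop.
  by apply/forallP => i; rewrite !mnmE.
- by move=> _ /mapP[u us ->] u0; apply: A1p; rewrite -mpolyX0 -u0; exact: I1s.
Qed.

Lemma monomial_grade_right :
  (monomial_grade (disjoint_product (mnm_ideal (K := K) A1) (mnm_ideal A2)) <=
   monomial_grade (mnm_ideal (K := K) A2))%N.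
Proof.
have [_ max2] := monomial_gradeP (mnm_ideal (K := K) A2).
have [[s [<- Is pws _]] _] := monomial_gradeP (disjoint_product (mnm_ideal (K := K) A1) (mnm_ideal A2)).
have I2s u : u \in s -> mnm_ideal (K := K) A2 'X_[mnm_right u].
  move=> /Is; rewrite disjoint_product_mnm !mnm_idealX => -[v [_ A2v]].
  rewrite -(mnm_joinK v) -(mnm_joinK u) mnm_join_le mnm_rightK => /andP[_ le2].
  by exists (mnm_right v).
apply: max2; exists (map (@mnm_right n m) s); rewrite size_map; split=> //.
- by move=> _ /mapP[u us ->]; exact: I2s.
- rewrite pairwise_map; apply: sub_pairwise pws => u v /forallP cop.
  by apply/forallP => i; rewrite !mnmE.
- by move=> _ /mapP[u us ->] u0; apply: A2p; rewrite -mpolyX0 -u0; exact: I2s.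
Qed.

Hypotheses (sq1 : forall u, A1 u -> sqfree_mnm u) (sq2 : forall v, A2 v -> sqfree_mnm v).

(** The bound on [k] keeps both squarefree powers nonzero, as the depth formula
    requires; the [+ 1] of that formula balances the two shifts by one in the
    definition of the normalized depth. *)
Lemma norm_depth_product k : (1 <= k)%N ->
  (k <= monomial_grade (disjoint_product (mnm_ideal (K := K) A1) (mnm_ideal A2)))%N ->
  norm_depth (disjoint_product (mnm_ideal (K := K) A1) (mnm_ideal A2)) k =
  norm_depth (mnm_ideal (K := K) A1) k + norm_depth (mnm_ideal (K := K) A2) k.
Proof.
move=> k0 lek.
have nz1 := sqfree_pow_nonzero sq1 (leq_trans lek monomial_grade_left).
have nz2 := sqfree_pow_nonzero sq2 (leq_trans lek monomial_grade_right).
have p1 := sqfree_pow_proper A1p k0; have p2 := sqfree_pow_proper A2p k0.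
rewrite /norm_depth sqfree_pow_product !sqfree_pow_mnm indeg_join // depth_join //.
lia.
Qed.

End ProductDepth.

Lemma sqfree_monomial_idealP (K : fieldType) n (I : {mpoly K[n]} -> Prop) :
  sqfree_monomial_ideal I -> exists A : 'X_{1..n} -> Prop,
  [/\ I = mnm_ideal A, forall u, A u -> sqfree_mnm u & ~ mnm_ideal A (1 : {mpoly K[n]})].
Proof.
case=> -[A sqA IA] _ nI1; have E : I = mnm_ideal A by exact: pred_ext.
by exists A; split=> //; rewrite -E.
Qed.

Theorem corollary2p2 (K : fieldType) (n m : nat)
    (I1 : {mpoly K[n]} -> Prop) (I2 : {mpoly K[m]} -> Prop)
    (hI1 : sqfree_monomial_ideal I1) (hI2 : sqfree_monomial_ideal I2)
    (supp1 : full_support I1) (supp2 : full_support I2)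
    (g1 : norm_depth_nonincreasing I1) (g2 : norm_depth_nonincreasing I2) :
  norm_depth_nonincreasing (disjoint_product I1 I2).
Proof.
have [A1 [E1 sq1 p1]] := sqfree_monomial_idealP hI1.
have [A2 [E2 sq2 p2]] := sqfree_monomial_idealP hI2.
subst I1 I2 => k l k1 lekl lel.
rewrite !norm_depth_product //; [|exact: leq_trans lekl lel|exact: leq_trans k1 lekl].
apply: lerD; [apply: g1 | apply: g2] => //; apply: leq_trans lel _.
  exact: monomial_grade_left.
exact: monomial_grade_right.
Qed.
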